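(* Let $n\ge 1$, $V=\mathbb{C}^n$, and let $T=T(V)\otimes T(V^* )$ be the mixed tensor algebra over $V$. Let $S\subseteq T$ and let $G$ be a $*$-subgroup of $\mathrm{GL}(n,\mathbb{C})$ with $\mathcal{U}(n)^S\subseteq G\subseteq \mathrm{GL}(n,\mathbb{C})^S$. Then $T^G$ is equal to the smallest contraction-closed graded $*$-subalgebra of $T$ containing $S\cup\{I\}$, where $I=\sum_{i=1}^n e_i\otimes e_i^*$.
   Context: $T(V)=\bigoplus_{k\ge 0}V^{\otimes k}$, $T(V^* )=\bigoplus_{k\ge 0}V^{*\otimes k}$, and $T=T(V)\otimes T(V^* )\cong\bigoplus_{k,l\ge 0}V^{\otimes k}\otimes V^{*\otimes l}$, with multiplication (also written $\otimes$) $(x\otimes y)\otimes(x'\otimes y')=(x\otimes x')\otimes(y\otimes y')$ for $x,x'\in T(V)$, $y,y'\in T(V^* )$. For $U\in \mathrm{GL}(n,\mathbb{C})$, $z\mapsto z^U$ is the unique algebra endomorphism of $T$ with $x^U=Ux$ for $x\in V$ and $y^U=(U^{\mathsf T})^{-1}y$ for $y\in V^*$ (coordinates with respect to the dual basis; i.e. $y^U=y\circ U^{-1}$). For $G\subseteq \mathrm{GL}(n,\mathbb{C})$, $T^G:=\{z\in T\mid z^U=z \text{ for all } U\in G\}$. For $S\subseteq T$ and $K\subseteq\mathrm{GL}(n,\mathbb{C})$, $K^S:=\{U\in K\mid z^U=z\text{ for all }z\in S\}$. $\mathcal{U}(n)$ is the unitary group. A subgroup $G$ of $\mathrm{GL}(n,\mathbb{C})$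 is a $*$-subgroup if $G=G^*:=\{U^*\mid U\in G\}$ ($U^*$ the conjugate transpose). Graded: for $A\subseteq T$ put $A_{k,l}:=A\cap(V^{\otimes k}\otimes V^{*\otimes l})$; a subalgebra $A$ of $T$ is graded if $A=\bigoplus_{k,l\ge0}A_{k,l}$. $*$-operation: let $e_1,\ldots,e_n$ be the standard basis of $V$ and $e_1^*,\ldots,e_n^*$ the dual basis of $V^*$. The map $e_i\mapsto e_i^*$ extends to a unique function $x\mapsto x^*$ on $T$ with $(x^* )^*=x$, $(\lambda x)^*=\overline{\lambda}x^*$, $(x+y)^*=x^*+y^*$, $(x\otimes y)^*=y^*\otimes x^*$ for all $x,y\in T$, $\lambda\in\mathbb{C}$. A subalgebra $A$ of $T$ is a $*$-subalgebra if $A^*=A$. Contraction-closed: a graded subalgebra is contraction-closed if it is closed under all contraction operators $V^{\otimes k}\otimes V^{*\otimes l}\to V^{\otimes (k-1)}\otimes V^{*\otimes (l-1)}$ ($k,l\ge1$) that pair the $i$-th $V$-factor with the $j$-th $V^*$-factor, $1\le i\le k$, $1\le j\le l$. *)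

(* Defs.v *)
From HB Require Import structures.
From mathcomp Require Import all_boot all_order all_algebra.
From mathcomp Require Import sesquilinear spectral.
From mathcomp Require Import boolp classical_sets.
From mathcomp Require Import finmap monalg.

Set Implicit Arguments.
Unset Strict Implicit.
Unset Printing Implicit Defensive.

Import GRing.Theory Num.Theory.

Local Open Scope classical_set_scope.
Local Open Scope ring_scope.

(* The definitions make sense over any numClosedFieldType C; the complex
   numbers are C := R[i] with R : realType.                                   *)

Section ProdMonom.
Variables M N : monomType.
Implicit Types x y : (M * N)%type.

Definition prodm_one : M * N := (mone, mone).
Definition prodm_mul x y : M * N := (mmul x.1 y.1, mmul x.2 y.2).

Fact prodm_mulA : associative prodm_mul.
Proof. by move=> x y z; rewrite /prodm_mul /= !mulmA. Qed.
Fact prodm_mul1m : left_id prodm_one prodm_mul.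
Proof. by case=> x y; rewrite /prodm_mul /= !mul1m. Qed.
Fact prodm_mulm1 : right_id prodm_one prodm_mul.
Proof. by case=> x y; rewrite /prodm_mul /= !mulm1. Qed.
Fact prodm_unitm x y :
  prodm_mul x y = prodm_one -> x = prodm_one /\ y = prodm_one.
Proof.
by case: x y => [x1 x2] [y1 y2] [] /unitm[-> ->] /unitm[-> ->].
Qed.

HB.instance Definition _ := Choice_isMonomialDef.Build (M * N)%type
  prodm_mulA prodm_mul1m prodm_mulm1 prodm_unitm.
End ProdMonom.

(* With V = C^n, T(V) is the algebra of the free monoid on e_1, ..., e_n,
   T(V^* ) that of the free monoid on the dual basis, so T(V) (x) T(V^* ) is
   the algebra of the product of two free monoids: its basis consists of the
   pairs (u, v) of words in 'I_n, where (u, v) stands for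
   e_(u_1) (x) ... (x) e_(u_k) (x) e*_(v_1) (x) ... (x) e*_(v_l).             *)
Notation biword n := ({fmonom 'I_n} * {fmonom 'I_n})%type.
Notation mtensor C n := {malg C[biword n]}.

Section MixedTensors.
Variables (C : numClosedFieldType) (n : nat).
Local Notation T := (mtensor C n).
Implicit Types (U : 'M[C]_n) (G K : set 'M[C]_n) (A S : set T) (z : T).

Definition tbasis (m : biword n) : T := << m >>.
Definition e_ (i : 'I_n) : T := tbasis (fmu i, mone).
Definition estar_ (i : 'I_n) : T := tbasis (mone, fmu i).

(* V and V^* (in coordinates for the dual basis) inside T *)
Definition vect (x : 'cV[C]_n) : T := \sum_i x i 0 *: e_ i.
Definition covect (y : 'cV[C]_n) : T := \sum_i y i 0 *: estar_ i.

Definition tensI : T := \sum_i e_ i * estar_ i.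

Definition linext (h : biword n -> T) z : T :=
  \sum_(m <- msupp z) z@_m *: h m.

(* z^U; see tactM, tact1, tactP, tact_vect, tact_covect below for the
   characterization as an algebra endomorphism.                               *)
Definition tact_word U (m : biword n) : T :=
  (\prod_(i <- (m.1 : seq 'I_n)) vect (U *m delta_mx i 0)) *
  (\prod_(j <- (m.2 : seq 'I_n)) covect (invmx U^T *m delta_mx j 0)).
Definition tact U : T -> T := linext (tact_word U).

(* (e_u (x) e*_v)^* = e_(rev v) (x) e*_(rev u), extended conjugate-linearly *)
Definition star_word (m : biword n) : biword n :=
  (FMonom (rev m.2), FMonom (rev m.1)).
Definition tstar z : T :=
  \sum_(m <- msupp z) (z@_m)^* *: tbasis (star_word m).

(* The contraction pairing the V-factor number i with the V^*-factor number j
   (both counted from 0); only meaningful on biwords having such factors.     *)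
Definition del_nth (i : nat) (s : seq 'I_n) : seq 'I_n :=
  take i s ++ drop i.+1 s.
Definition contr_word (i j : nat) (m : biword n) : T :=
  if onth m.1 i == onth m.2 j
  then tbasis (FMonom (del_nth i m.1), FMonom (del_nth j m.2)) else 0.
Definition contraction (i j : nat) : T -> T := linext (contr_word i j).

(* V^{(x) k} (x) V^{* (x) l} *)
Definition bidegree (k l : nat) : set T :=
  [set z | forall m, m \in msupp z -> fdeg m.1 = k /\ fdeg m.2 = l].

(* Subalgebras are unital. For contraction-closed ones containing I this is no
   restriction when n > 0, as the contraction of I is n in C = A_{0,0}.       *)
Definition subalgebra A : Prop :=
  [/\ A 1, forall a x y, A x -> A y -> A (a *: x + y)
    & forall x y, A x -> A y -> A (x * y)].

(* A is the sum of its subspaces A `&` bidegree k l; the sum is automatically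
   direct since the supports of different bidegrees are disjoint.             *)
Definition graded A : Prop :=
  forall z, A z <->
    exists d (y : nat -> nat -> T),
      (forall k l, (A `&` bidegree k l) (y k l)) /\
      z = \sum_(k < d) \sum_(l < d) y k l.

Definition star_closed A : Prop := [set tstar z | z in A] = A.

Definition contraction_closed A : Prop :=
  forall k l i j, (i < k)%N -> (j < l)%N ->
  forall z, (A `&` bidegree k l) z -> A (contraction i j z).

Definition contraction_closed_graded_star_subalgebra A : Prop :=
  [/\ subalgebra A, graded A, star_closed A & contraction_closed A].

Definition GL : set 'M[C]_n := [set U | U \in unitmx].
Definition unitary_group : set 'M[C]_n := [set U | U \is unitarymx].

Definition GL_subgroup G : Prop :=
  [/\ G `<=` GL, G 1%:M, forall U W, G U -> G W -> G (U *m W)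
    & forall U, G U -> G (invmx U)].

Definition star_subgroup G : Prop :=
  GL_subgroup G /\ [set (U ^t*)%sesqui | U in G] = G.

(* T^G and K^S *)
Definition invariants G : set T := [set z | forall U, G U -> tact U z = z].
Definition stabilizer K S : set 'M[C]_n :=
  [set U | K U /\ forall z, S z -> tact U z = z].

End MixedTensors.

Arguments GL {C n}.
Arguments unitary_group {C n}.
Arguments tensI {C n}.

Section MorphFromBasis.
Variables (C : numClosedFieldType) (A : lalgType C) (I : Type) (b : I -> A).
Hypothesis scaleAr : forall c (x y : A), c *: (x * y) = x * (c *: y).
Hypothesis basis_ind : forall P : A -> Prop,
  P 0 -> (forall c i y, P y -> P (c *: b i + y)) -> forall x, P x.

Lemma antimorph_from_basis (s : A -> A) :
  (forall c x y, s (c *: x + y) = c^* *: s x + s y) ->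
  (forall i j, s (b i * b j) = s (b j) * s (b i)) ->
  forall x y, s (x * y) = s y * s x.
Proof.
move=> sP sM; have s0 : s 0 = 0.
  by have := sP (-1) 0 0; rewrite scaler0 addr0 rmorphN1 scaleN1r addNr.
move=> x y; move: x; apply: basis_ind => [|c i x IHx].
  by rewrite mul0r s0 mulr0.
rewrite mulrDl -scalerAl !sP IHx mulrDr -scaleAr.
congr (_ *: _ + _); move: y {IHx x}; apply: basis_ind => [|e j y IHy].
  by rewrite mulr0 s0 mul0r.
by rewrite mulrDr -scaleAr !sP IHy mulrDl -scalerAl sM.
Qed.

Lemma morph_from_basis (s : A -> A) :
  (forall c x y, s (c *: x + y) = c *: s x + s y) ->
  (forall i j, s (b i * b j) = s (b i) * s (b j)) ->
  forall x y, s (x * y) = s x * s y.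
Proof.
move=> sP sM; have s0 : s 0 = 0.
  by have := sP (-1) 0 0; rewrite scaler0 addr0 scaleN1r addNr.
move=> x y; move: x; apply: basis_ind => [|c i x IHx].
  by rewrite mul0r s0 mul0r.
rewrite mulrDl -scalerAl !sP IHx mulrDl -scalerAl.
congr (_ *: _ + _); move: y {IHx x}; apply: basis_ind => [|e j y IHy].
  by rewrite mulr0 s0 mulr0.
by rewrite mulrDr -scaleAr !sP IHy mulrDr -scaleAr sM.
Qed.
End MorphFromBasis.

Section LinearCombinations.
Variables (C : numClosedFieldType) (n : nat).

Lemma lincomb_mulmx (E : lmodType C) (e : 'I_n -> E) (M : 'M[C]_n)
    (x : 'cV[C]_n) :
  \sum_k (M *m x) k 0 *: e k =
  \sum_i x i 0 *: \sum_k (M *m (delta_mx i 0 : 'cV[C]_n)) k 0 *: e k.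
Proof.
under [RHS]eq_bigr do rewrite scaler_sumr.
rewrite exchange_big; apply: eq_bigr => k _.
under eq_bigr do rewrite scalerA.
rewrite -scaler_suml mxE; congr (_ *: _); apply: eq_bigr => i _.
by rewrite -colE mxE mulrC.
Qed.

Lemma lincomb_comm (A : lalgType C) (e f : 'I_n -> A) (x y : 'cV[C]_n) :
  (forall c (u v : A), c *: (u * v) = u * (c *: v)) ->
  (forall i j, e i * f j = f j * e i) ->
  (\sum_i x i 0 *: e i) * (\sum_j y j 0 *: f j) =
  (\sum_j y j 0 *: f j) * (\sum_i x i 0 *: e i).
Proof.
move=> scaleAr efC; rewrite big_distrlr [RHS]big_distrlr /= exchange_big /=.
apply: eq_bigr => j _; apply: eq_bigr => i _.
by rewrite -!scalerAl -!scaleAr efC !scalerA mulrC.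
Qed.

Lemma lincomb_linear (E : lmodType C) (s : E -> E) (F : 'I_n -> C)
    (e : 'I_n -> E) :
  (forall c x y, s (c *: x + y) = c *: s x + s y) ->
  s (\sum_i F i *: e i) = \sum_i F i *: s (e i).
Proof.
move=> sP; have s0 : s 0 = 0.
  by have := sP (-1) 0 0; rewrite scaler0 addr0 scaleN1r addNr.
elim: (index_enum _) => [|i r IHr]; first by rewrite !big_nil.
by rewrite !big_cons sP IHr.
Qed.

Lemma prod_cat_comm (A : lalgType C) (f g : 'I_n -> A) (s s' t t' : seq 'I_n) :
  (forall i j, f i * g j = g j * f i) ->
  (\prod_(i <- s ++ s') f i) * (\prod_(j <- t ++ t') g j) =
  (\prod_(i <- s) f i) * (\prod_(j <- t) g j) *
  ((\prod_(i <- s') f i) * (\prod_(j <- t') g j)).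
Proof.
move=> fgC; rewrite !big_cat /= -!mulrA; congr (_ * _).
rewrite !mulrA; congr (_ * _).
apply: commr_prod => j _; apply/commr_sym/commr_prod => i _.
by rewrite /GRing.comm fgC.
Qed.
End LinearCombinations.

Section MixedTensorTheory.
Variables (C : numClosedFieldType) (n : nat).
Local Notation T := (mtensor C n).
Implicit Types (U : 'M[C]_n) (z : T).

Lemma fmonom_mulE (u v : {fmonom 'I_n}) : mmul u v = FMonom (u ++ v).
Proof. by rewrite /mmul /= fmmulE. Qed.
Lemma biword_mulE (p q : biword n) :
  mmul p q = (FMonom (p.1 ++ q.1), FMonom (p.2 ++ q.2)).
Proof. by rewrite -!fmonom_mulE. Qed.

Lemma tbasisM (p q : biword n) : tbasis C (mmul p q) = tbasis C p * tbasis C q.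
Proof. by rewrite /tbasis malgM_def fgmulUU mulr1. Qed.

Lemma star_wordK : involutive (@star_word n).
Proof. by case=> -[u] [v]; rewrite /star_word /= !revK. Qed.

Lemma star_wordM (p q : biword n) :
  star_word (mmul p q) = mmul (star_word q) (star_word p).
Proof. by rewrite !biword_mulE /star_word /= !rev_cat. Qed.

Lemma tstarE z m : (tstar z)@_m = (z@_(star_word m))^*.
Proof.
rewrite /tstar raddf_sum /=.
under eq_bigr do rewrite mcoeffZ mcoeffU1 -(inj_eq (can_inj star_wordK)) star_wordK.
have [mz|mz] := boolP (star_word m \in msupp z).
  rewrite (big_fsetD1 _ mz) /= eqxx mulr1 big_seq big1 ?addr0 // => k.
  by rewrite in_fsetD1 => /andP[/negPf -> _]; rewrite mulr0.
rewrite mcoeff_outdom // conjC0 big_seq big1 // => k kz.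
by case: eqP mz kz => [->|_ _ _]; [move=> /negPf -> | rewrite mulr0].
Qed.

Lemma tstarK : involutive (@tstar C n).
Proof. by move=> z; apply/malgP => m; rewrite !tstarE star_wordK conjCK. Qed.

Lemma tstarD x y : tstar (x + y) = tstar x + tstar y :> T.
Proof.
apply/malgP => m; apply: (etrans (tstarE _ _)).
apply: (etrans (congr1 Num.conj (mcoeffD _ _ _))).
apply: (etrans (rmorphD Num.conj _ _)); apply/esym.
apply: (etrans (mcoeffD _ _ _)).
by congr (_ + _); apply: tstarE.
Qed.

Lemma tstarZ a z : tstar (a *: z) = a^* *: tstar z.
Proof.
apply/malgP => m; apply: (etrans (tstarE _ _)).
apply: (etrans (congr1 Num.conj (mcoeffZ _ _ _))).
apply: (etrans (rmorphM Num.conj _ _)); apply/esym.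
apply: (etrans (mcoeffZ _ _ _)).
by congr (_ * _); apply: tstarE.
Qed.

Lemma tstar_tbasis (m : biword n) : tstar (tbasis C m) = tbasis C (star_word m).
Proof.
apply/malgP => k; rewrite tstarE /tbasis !mcoeffU1 conjC_nat.
by rewrite -(inj_eq (can_inj star_wordK)) star_wordK.
Qed.

Lemma tstar_e_ (i : 'I_n) : tstar (e_ C i) = estar_ C i.
Proof.
rewrite tstar_tbasis /estar_ /star_word /= /mone /= fmoneE fmuE.
by [].
Qed.

Lemma mtensorE z : z = \sum_(m <- msupp z) z@_m *: tbasis C m.
Proof.
rewrite {1}[z]monalgE; apply: eq_bigr => m _; apply/malgP => k.
apply: (etrans (mcoeffU _ _ _)); apply/esym/(etrans (mcoeffZ _ _ _)).
by rewrite mcoeffU1 mulr_natr.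
Qed.

Lemma mtensor_ind (P : T -> Prop) :
  P 0 -> (forall a m y, P y -> P (a *: tbasis C m + y)) -> forall z, P z.
Proof.
move=> P0 PS z; rewrite [z]mtensorE; elim: (X in \sum_(m <- X) _) => [|k s IH].
  by rewrite big_nil.
by rewrite big_cons; apply: PS.
Qed.

Lemma mtensor_scalerAr a (x y : T) : a *: (x * y) = x * (a *: y).
Proof.
apply/esym/(etrans (malgMEw (fsubset_refl _) (msuppZ_le a y)))/esym.
apply: (etrans (congr1 _ (malgME _ _))); rewrite scaler_sumr.
apply: eq_bigr => p _; rewrite scaler_sumr; apply: eq_bigr => q _.
apply/malgP => k; apply: (etrans (mcoeffZ _ _ _)).
apply: (etrans (congr1 _ (mcoeffU _ _ _))).
apply/esym/(etrans (mcoeffU _ _ _)).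
apply: (etrans (congr1 (fun c => _ * c *+ _) (mcoeffZ _ _ _))).
by rewrite mulrnAr mulrCA.
Qed.

Lemma tstarM x y : tstar (x * y) = tstar y * tstar x :> T.
Proof.
apply: (antimorph_from_basis mtensor_scalerAr mtensor_ind) => [a u v|p q].
  by apply: (etrans (tstarD _ _)); congr (_ + _); apply: tstarZ.
apply: (etrans (congr1 (@tstar C n) (esym (tbasisM p q)))).
apply: (etrans (tstar_tbasis _)); rewrite star_wordM.
apply: (etrans (tbasisM _ _)).
by congr (_ * _); apply/esym/tstar_tbasis.
Qed.

Section LinExt.
Variable h : biword n -> T.
Lemma linextE z : linext h z = mmap (@malgC _ C) h z.
Proof. by rewrite mmapE; apply: eq_bigr => m _; rewrite mul_malgC. Qed.
Lemma linext_tbasis (m : biword n) : linext h (tbasis C m) = h m.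
Proof. by rewrite linextE mmapU mul_malgC scale1r. Qed.
Lemma linextP a x y : linext h (a *: x + y) = a *: linext h x + linext h y.
Proof.
rewrite !linextE mmapD; congr (_ + _); rewrite (mmapEw (msuppZ_le _ _)) mmapE.
rewrite scaler_sumr; apply: eq_bigr => m _.
apply: (etrans (mul_malgC _ _)).
apply: (etrans (congr1 (fun c => c *: h m) (mcoeffZ a x m))).
apply: (etrans (esym (scalerA _ _ _))); congr (_ *: _).
exact: (esym (mul_malgC _ _)).
Qed.
Lemma linextM : (forall p q, h (mmul p q) = h p * h q) ->
  forall x y, linext h (x * y) = linext h x * linext h y.
Proof.
move=> hM; apply: (morph_from_basis mtensor_scalerAr mtensor_ind) => [|p q]; first exact: linextP.
apply: (etrans (congr1 (linext h) (esym (tbasisM p q)))).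
apply: (etrans (linext_tbasis _)); rewrite hM.
by congr (_ * _); apply/esym/linext_tbasis.
Qed.
End LinExt.

Lemma e_estarC (i j : 'I_n) : e_ C i * estar_ C j = estar_ C j * e_ C i.
Proof.
apply: (etrans (esym (tbasisM _ _))); apply: (etrans _ (tbasisM _ _)).
by congr (tbasis _ _); rewrite /mmul /= /prodm_mul /= !mulm1 !mul1m.
Qed.

Lemma vect_covectC (x y : 'cV[C]_n) : vect x * covect y = covect y * vect x.
Proof.
exact: (lincomb_comm x y mtensor_scalerAr e_estarC).
Qed.

Lemma tact_wordM U (p q : biword n) : tact_word U (mmul p q) = tact_word U p * tact_word U q.
Proof.
rewrite biword_mulE; apply: prod_cat_comm => i j; exact: vect_covectC.
Qed.

Lemma tactM U x y : tact U (x * y) = tact U x * tact U y.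
Proof. exact/linextM/tact_wordM. Qed.
Lemma tactP U a x y : tact U (a *: x + y) = a *: tact U x + tact U y.
Proof. exact: linextP. Qed.
Lemma tact1 U : tact U 1 = 1.
Proof.
have -> : 1 = tbasis C (mone : biword n) by [].
apply: (etrans (linext_tbasis _ _)); rewrite /tact_word /= fm1.
by rewrite [X in X * _]big_nil [X in _ * X]big_nil mul1r.
Qed.
Lemma linext_sum h (F : 'I_n -> C) (b : 'I_n -> T) :
  linext h (\sum_i F i *: b i) = \sum_i F i *: linext h (b i).
Proof.
exact/lincomb_linear/linextP.
Qed.

Lemma tact_e_ U (i : 'I_n) : tact U (e_ C i) = vect (U *m delta_mx i 0).
Proof.
apply: (etrans (linext_tbasis _ _)); rewrite /tact_word /= fm1 fmU.
by rewrite [X in X * _]big_seq1 [X in _ * X]big_nil mulr1.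
Qed.

Lemma tact_estar_ U (i : 'I_n) : tact U (estar_ C i) = covect (invmx U^T *m delta_mx i 0).
Proof.
apply: (etrans (linext_tbasis _ _)); rewrite /tact_word /= fm1 fmU.
by rewrite [X in X * _]big_nil [X in _ * X]big_seq1 mul1r.
Qed.

Lemma tact_vect U x : tact U (vect x) = vect (U *m x).
Proof.
apply: (etrans (linext_sum _ _ _)); apply/esym.
apply: (etrans (lincomb_mulmx _ _ _)); apply: eq_bigr => i _; congr (_ *: _).
exact/esym/tact_e_.
Qed.

Lemma tact_covect U y : tact U (covect y) = covect (invmx U^T *m y).
Proof.
apply: (etrans (linext_sum _ _ _)); apply/esym.
apply: (etrans (lincomb_mulmx _ _ _)); apply: eq_bigr => i _; congr (_ *: _).
exact/esym/tact_estar_.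
Qed.

Lemma contraction_tbasis i j (m : biword n) :
  contraction i j (tbasis C m) = contr_word C i j m.
Proof. exact: linext_tbasis. Qed.

End MixedTensorTheory.

(* Main.v *)
Require Import Defs.
From HB Require Import structures.
From mathcomp Require Import all_boot all_order all_algebra.
From mathcomp Require Import fingroup perm sesquilinear spectral ring lra.
From mathcomp Require Import boolp classical_sets reals complex finmap monalg filter.

Set Implicit Arguments.
Unset Strict Implicit.
Unset Printing Implicit Defensive.

Import Order.TTheory GRing.Theory Num.Theory.

Local Open Scope classical_set_scope.
Local Open Scope ring_scope.

(** Why the theorem is true.  That T^G is a contraction-closed graded
    star-subalgebra is a direct check: products, homogeneous components and
    contractions commute with the action of GL(n), and star intertwines U with
    its inverse adjoint.  It contains S and I, so only one inclusion has content:
    a closed algebra A that contains S and I contains T^G.  A unitary matrix that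
    fixes A fixes S, hence lies in G, so it is enough to show that A contains
    every tensor z fixed by the unitary stabilizer H of A
    ([invariant_in_ccalg]).  Projecting z orthogonally to A in each bidegree, one
    may take z orthogonal to A, and then has to show z = 0.

    Two algebraic facts are used.  The orthogonal complement of A is a module
    over A, because the adjoint of a multiplication by an element of A is made of
    star, products and contractions ([cc_perp_mul]); and A contains all permuted
    powers of I ([cc_Jperm]).  By the first fundamental theorem for U(n)
    ([fft_orth]), proved here by the double commutant argument, permuted powers of
    I suffice to detect invariants of U(n).  Hence, for b and b' in A, the mean
    over U in U(n) of <b^U, b'> <z^U, z> = <(b z)^U, b' z> vanishes
    ([matcoef_mean_eq0]).

    The functions <b^U, b'> generate an algebra that separates the cosets of H,
    and one could now invoke the Stone-Weierstrass theorem.  A single peaked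
    function does instead: if h is 1 minus a small multiple of the displacement of
    finitely many elements of A by U, then h^N concentrates on H, where <z^U, z>
    is |z|^2.  So if z were not 0, the means of h^N could not be orthogonal to
    <z^U, z> without decaying geometrically, at a rate excluded by covering U(n)
    by finitely many translates of a neighbourhood of H ([invariant_perp_eq0]).

    The mean over U(n) is obtained without measure theory, as a limit along an
    ultrafilter of averages over finite lists of unitary matrices.  Lists that
    nearly minimize the norms of the averaged tensors have nearly invariant
    averages, by the parallelogram law ([mean_exists]). *)

(** * Words, Kronecker powers and coefficients of the action *)

Section Words.
Variables (C : numClosedFieldType) (n : nat).
Local Notation T := (mtensor C n).
Implicit Types (U : 'M[C]_n) (z : T) (s t : seq 'I_n).

(** The word basis of T, on pairs of plain sequences of letters. *)
Definition bw s t : biword n := (FMonom s, FMonom t).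

Lemma bwE (m : biword n) : m = bw m.1 m.2.
Proof. by case: m => -[u] [v]. Qed.

Lemma bw_eq s t s' t' : (bw s t == bw s' t') = (s == s') && (t == t').
Proof. by []. Qed.

Lemma mmul_bw s t s' t' : mmul (bw s t) (bw s' t') = bw (s ++ s') (t ++ t').
Proof. by rewrite biword_mulE. Qed.

Lemma coef_tbasis (m k : biword n) : (tbasis C m)@_k = (m == k)%:R.
Proof. exact: mcoeffU1. Qed.

Definition lin (E : lmodType C) (f : T -> E) :=
  forall a x y, f (a *: x + y) = a *: f x + f y.

Lemma lin0 (E : lmodType C) (f : T -> E) : lin f -> f 0 = 0.
Proof. by move=> fP; have := fP (-1) 0 0; rewrite scaler0 addr0 scaleN1r addNr. Qed.

Lemma linZ (E : lmodType C) (f : T -> E) : lin f -> forall a x, f (a *: x) = a *: f x.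
Proof. by move=> fP a x; have := fP a x 0; rewrite addr0 (lin0 fP) addr0. Qed.

Lemma lin_ext (E : lmodType C) (f g : T -> E) : lin f -> lin g ->
  (forall m, f (tbasis C m) = g (tbasis C m)) -> f =1 g.
Proof.
move=> fP gP fg; apply: mtensor_ind => [|a m y fgy].
  by rewrite (lin0 fP) (lin0 gP).
by rewrite fP gP fg fgy.
Qed.

Lemma coef_is_lin m : lin (fun z : T => (z@_m : C^o)).
Proof. by move=> a x y; rewrite mcoeffD mcoeffZ. Qed.

Lemma big_tupleS (E : nmodType) k (F : seq 'I_n -> E) :
  \sum_(t : k.+1.-tuple 'I_n) F t = \sum_a \sum_(t : k.-tuple 'I_n) F (a :: t).
Proof.
rewrite pair_big /=.
rewrite (reindex (fun p : 'I_n * k.-tuple 'I_n => [tuple of p.1 :: p.2])) //=.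
exists (fun t : k.+1.-tuple 'I_n => (thead t, [tuple of behead t])) => [[a t] _|t _] /=.
  by congr pair; apply: val_inj.
by rewrite -tuple_eta.
Qed.

Lemma big_tuple0 (E : nmodType) (F : seq 'I_n -> E) :
  \sum_(t : 0.-tuple 'I_n) F t = F [::].
Proof.
rewrite (big_pred1 [tuple]) //= => t; apply/esym/eqP; exact: tuple0.
Qed.

(** Collapses the sums over words that arise when a tensor is expanded in the
    word basis; the length test takes the place of the missing summand. *)
Lemma big_tuple_pick (E : pzSemiRingType) k (u : seq 'I_n) (F : seq 'I_n -> E) :
  \sum_(t : k.-tuple 'I_n) F t * (u == t)%:R = if size u == k then F u else 0.
Proof.
case: eqP => [uk|/eqP uk].
  have uk' : size u == k by apply/eqP.
  rewrite (bigD1 (Tuple uk')) //= eqxx mulr1 big1 ?addr0 // => t tu.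
  case: eqP => [ut|]; last by rewrite mulr0.
  by case/eqP: tu; apply: val_inj.
rewrite big1 // => t _; case: eqP => [ut|]; last by rewrite mulr0.
by move: uk; rewrite ut size_tuple eqxx.
Qed.

(** Entries of the Kronecker powers of M, all at once: rows and columns are
    indexed by words, and words of different lengths do not interact. *)
Fixpoint kron (M : 'M[C]_n) s t : C :=
  match s, t with
  | [::], [::] => 1
  | a :: s', b :: t' => M a b * kron M s' t'
  | _, _ => 0
  end.

Lemma kron_size M s t : size s != size t -> kron M s t = 0.
Proof.
elim: s t => [|a s IH] [|b t] //= st; by rewrite IH ?mulr0.
Qed.

Lemma kron_cat M s t s' t' : size s = size t ->
  kron M (s ++ s') (t ++ t') = kron M s t * kron M s' t'.
Proof.
elim: s t => [|a s IH] [|b t] //=; first by rewrite mul1r.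
by move=> [st]; rewrite IH // mulrA.
Qed.

Lemma kron_rev M s t : kron M (rev s) (rev t) = kron M s t.
Proof.
have [st|st] := eqVneq (size s) (size t); last by rewrite !kron_size // !size_rev.
elim: s t st => [|a s IH] [|b t] //= [st]; rewrite !rev_cons -!cats1 kron_cat ?size_rev //.
by rewrite IH //= mulr1 mulrC.
Qed.

Lemma kron1 s t : kron 1%:M s t = (s == t)%:R.
Proof.
elim: s t => [|a s IH] [|b t] //=; rewrite IH mxE eqseq_cons.
by case: (a == b); rewrite ?mul1r ?mul0r.
Qed.

Lemma kron_tr M s t : kron M^T s t = kron M t s.
Proof. by elim: s t => [|a s IH] [|b t] //=; rewrite IH mxE. Qed.

Lemma kron_conj M s t : kron (map_mx Num.conj M) s t = (kron M s t)^*.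
Proof.
elim: s t => [|a s IH] [|b t] //=; rewrite ?rmorph1 ?rmorph0 //.
by rewrite IH mxE rmorphM.
Qed.

Lemma kron_mul M N s r k : size s = k ->
  kron (M *m N) s r = \sum_(t : k.-tuple 'I_n) kron M s t * kron N t r.
Proof.
elim: k s r => [|k IH] [|a s] r //= sk.
  by rewrite (big_tuple0 (fun t => kron M [::] t * kron N t r)); case: r => /=; rewrite ?mulr1 ?mulr0.
case: sk => sk; rewrite (big_tupleS k (fun t => kron M (a :: s) t * kron N t r)).
case: r => [|b r] /=; first by rewrite big1 // => i _; rewrite big1 // => t _; rewrite mulr0.
rewrite (IH s r) // mxE big_distrlr /=.
apply: eq_bigr => i _; apply: eq_bigr => t _; by rewrite mulrACA.
Qed.

Lemma big_tuple_cast (E : nmodType) k k' (F : seq 'I_n -> E) : k = k' ->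
  \sum_(t : k.-tuple 'I_n) F t = \sum_(t : k'.-tuple 'I_n) F t.
Proof. by move=> ->. Qed.

Lemma tmulDl a (u v x : T) : (a *: u + v) * x = a *: (u * x) + v * x.
Proof. by rewrite mulrDl -scalerAl. Qed.
Lemma tmulDr a (u v x : T) : x * (a *: u + v) = a *: (x * u) + x * v.
Proof. by rewrite mulrDr -mtensor_scalerAr. Qed.
Lemma mull_lin (x : T) : lin (fun z : T => x * z).
Proof. by move=> a u v; rewrite mulrDr -mtensor_scalerAr. Qed.
Lemma tcoefZ a (z : T) m : (a *: z)@_m = a * z@_m.
Proof. exact: mcoeffZ. Qed.
Lemma tcoefD (x y : T) m : (x + y)@_m = x@_m + y@_m.
Proof. exact: mcoeffD. Qed.
Lemma tcoef_sum (I : Type) (r : seq I) (P : pred I) (F : I -> T) m :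
  (\sum_(i <- r | P i) F i)@_m = \sum_(i <- r | P i) (F i)@_m.
Proof. exact: raddf_sum. Qed.

Lemma tbasis_mul s t s' t' :
  tbasis C (bw s t) * tbasis C (bw s' t') = tbasis C (bw (s ++ s') (t ++ t')).
Proof. by rewrite -tbasisM mmul_bw. Qed.

Lemma e_bw i : e_ C i = tbasis C (bw [:: i] [::]).
Proof. by rewrite /e_ /mone /= fmoneE fmuE. Qed.
Lemma estar_bw i : estar_ C i = tbasis C (bw [::] [:: i]).
Proof. by rewrite /estar_ /mone /= fmoneE fmuE. Qed.
Lemma one_bw : (1 : T) = tbasis C (bw [::] [::]).
Proof. by rewrite -[RHS]/(tbasis C (FMonom _, FMonom _)) -fmoneE. Qed.

Lemma coef_e_mul i (z : T) s t :
  (e_ C i * z)@_(bw s t) = if s is a :: s' then (i == a)%:R * z@_(bw s' t) else 0.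
Proof.
move: z; apply: (@lin_ext C^o _ (fun z => if s is a :: s' then (i == a)%:R * z@_(bw s' t) else 0)).
- move=> a x y; rewrite mull_lin; exact: coef_is_lin.
- move=> a x y; case: s => [|b s]; first by rewrite scaler0 addr0.
  by rewrite tcoefD tcoefZ mulrDr mulrCA.
move=> m; rewrite (bwE m) e_bw tbasis_mul coef_tbasis bw_eq.
case: s => [|a s] //=; rewrite coef_tbasis bw_eq eqseq_cons.
by case: (i == a); rewrite ?mul0r ?mul1r.
Qed.

Lemma coef_estar_mul i (z : T) s t :
  (estar_ C i * z)@_(bw s t) = if t is a :: t' then (i == a)%:R * z@_(bw s t') else 0.
Proof.
move: z; apply: (@lin_ext C^o _ (fun z => if t is a :: t' then (i == a)%:R * z@_(bw s t') else 0)).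
- move=> a x y; rewrite mull_lin; exact: coef_is_lin.
- move=> a x y; case: t => [|b t]; first by rewrite scaler0 addr0.
  by rewrite tcoefD tcoefZ mulrDr mulrCA.
move=> m; rewrite (bwE m) estar_bw tbasis_mul coef_tbasis bw_eq.
case: t => [|a t] //=; rewrite ?andbF // coef_tbasis bw_eq eqseq_cons.
by case: (i == a); rewrite ?mul0r ?mul1r // andbF.
Qed.

Lemma coef_vect_mul (x : 'cV[C]_n) (z : T) s t :
  (vect x * z)@_(bw s t) = if s is a :: s' then x a 0 * z@_(bw s' t) else 0.
Proof.
rewrite /vect mulr_suml tcoef_sum.
under eq_bigr => i _ do rewrite -scalerAl tcoefZ coef_e_mul.
case: s => [|a s]; first by rewrite big1 // => i _; rewrite mulr0.
rewrite (bigD1 a) //= eqxx mul1r big1 ?addr0 // => i /negPf ->.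
by rewrite mul0r mulr0.
Qed.

Lemma coef_covect_mul (x : 'cV[C]_n) (z : T) s t :
  (covect x * z)@_(bw s t) = if t is a :: t' then x a 0 * z@_(bw s t') else 0.
Proof.
rewrite /covect mulr_suml tcoef_sum.
under eq_bigr => i _ do rewrite -scalerAl tcoefZ coef_estar_mul.
case: t => [|a t]; first by rewrite big1 // => i _; rewrite mulr0.
rewrite (bigD1 a) //= eqxx mul1r big1 ?addr0 // => i /negPf ->.
by rewrite mul0r mulr0.
Qed.

Lemma mul_delta_col (M : 'M[C]_n) i j : (M *m (delta_mx i 0 : 'cV[C]_n)) j 0 = M j i.
Proof. by rewrite -colE mxE. Qed.

(** Coefficients are read off letter by letter: a factor vect x on the left of
    a tensor consumes the first V-letter, and a factor covect y the first
    V^*-letter. *)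
Lemma coef_tact_word U u v s t :
  (tact_word U (bw u v))@_(bw s t) = kron U s u * kron (invmx U^T) t v.
Proof.
rewrite /tact_word /=; set Q := (X in _ * X).
have QE s' t' : Q@_(bw s' t') = (s' == [::])%:R * kron (invmx U^T) t' v.
  rewrite /Q {Q s t}; elim: v s' t' => [|b v IH] s t.
    rewrite big_nil one_bw coef_tbasis bw_eq; case: s; case: t => //=; by rewrite ?mulr0 ?mulr1 ?mul0r.
  rewrite big_cons coef_covect_mul; case: t => [|a t] /=; first by rewrite mulr0.
  by rewrite IH mul_delta_col mulrCA.
elim: u s => [|b u IH] s.
  rewrite big_nil mul1r QE; by case: s.
rewrite big_cons -mulrA coef_vect_mul; case: s => [|a s] /=; first by rewrite mul0r.
by rewrite IH mul_delta_col mulrA.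
Qed.

Lemma tactE U z s t :
  (tact U z)@_(bw s t) = \sum_(s' : (size s).-tuple 'I_n) \sum_(t' : (size t).-tuple 'I_n)
    kron U s s' * kron (invmx U^T) t t' * z@_(bw s' t').
Proof.
move: z; apply: (@lin_ext C^o _ (fun z => \sum_(s' : (size s).-tuple 'I_n) \sum_(t' : (size t).-tuple 'I_n)
    kron U s s' * kron (invmx U^T) t t' * z@_(bw s' t'))).
- move=> a x y; rewrite tactP; exact: coef_is_lin.
- move=> a x y; rewrite scaler_sumr -big_split; apply: eq_bigr => s' _ /=.
  rewrite scaler_sumr -big_split; apply: eq_bigr => t' _ /=.
  by rewrite tcoefD tcoefZ mulrDr mulrCA.
move=> m; rewrite (bwE m); set u := m.1 : seq _; set v := m.2 : seq _.
rewrite [in LHS]/tact linext_tbasis coef_tact_word.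
under eq_bigr => s' _.
  under eq_bigr => t' _ do rewrite coef_tbasis bw_eq -mulnb natrM mulrA.
  rewrite (big_tuple_pick _ v (fun t' => kron U s s' * kron (invmx U^T) t t' * (u == s')%:R)).
  over.
case: eqP => [vt|/eqP vt]; last first.
  by rewrite big1 // [kron _ t v]kron_size ?mulr0 // eq_sym.
rewrite (big_tuple_pick _ u (fun s' => kron U s s' * kron (invmx U^T) t v)).
by case: eqP => [us//|/eqP us]; rewrite [kron _ s u]kron_size ?mul0r // eq_sym.
Qed.

End Words.

(** Sealed forms of the operations on T.  Unsealed, comparing two tensors would
    unfold linear extensions down to finitely supported functions. *)
HB.lock Definition act (C : numClosedFieldType) (n : nat) (U : 'M[C]_n)
  (z : mtensor C n) : mtensor C n := tact U z.
HB.lock Definition star (C : numClosedFieldType) (n : nat)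
  (z : mtensor C n) : mtensor C n := tstar z.
HB.lock Definition contr (C : numClosedFieldType) (n i j : nat)
  (z : mtensor C n) : mtensor C n := contraction i j z.
HB.lock Definition proj (C : numClosedFieldType) (n k l : nat)
  (z : mtensor C n) : mtensor C n :=
  linext (fun m : biword n =>
    if (size m.1 == k) && (size m.2 == l) then tbasis C m else 0) z.
HB.lock Definition eb (C : numClosedFieldType) (n : nat) (s t : seq 'I_n) :
  mtensor C n := tbasis C (bw s t).

Section Sealed.
Variables (C : numClosedFieldType) (n : nat).
Local Notation T := (mtensor C n).
Implicit Types (U W : 'M[C]_n) (x y z : T) (s t u v : seq 'I_n).

Lemma tbasisE m : tbasis C m = eb C m.1 m.2 :> T.
Proof. by rewrite unlock -bwE. Qed.
Lemma coef_eb u v s t : (eb C u v)@_(bw s t) = ((u == s) && (v == t))%:R.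
Proof. by rewrite unlock coef_tbasis bw_eq. Qed.
Lemma eb_mul s t s' t' : eb C s t * eb C s' t' = eb C (s ++ s') (t ++ t').
Proof. by rewrite unlock tbasis_mul. Qed.
Lemma one_eb : (1 : T) = eb C [::] [::].
Proof. by rewrite unlock; exact: one_bw. Qed.

(** In bidegree (k, l) the action of U is the k-th Kronecker power of U tensored
    with the l-th Kronecker power of its contragredient. *)
Lemma actE U z s t :
  (act U z)@_(bw s t) = \sum_(s' : (size s).-tuple 'I_n) \sum_(t' : (size t).-tuple 'I_n)
    kron U s s' * kron (invmx U^T) t t' * z@_(bw s' t').
Proof. by rewrite unlock; exact: tactE. Qed.
Lemma coef_act_eb U u v s t :
  (act U (eb C u v))@_(bw s t) = kron U s u * kron (invmx U^T) t v.
Proof. by rewrite !unlock /tact linext_tbasis coef_tact_word. Qed.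
Lemma actP U a x y : act U (a *: x + y) = a *: act U x + act U y.
Proof. by rewrite unlock; exact: tactP. Qed.
Lemma actM U x y : act U (x * y) = act U x * act U y.
Proof. by rewrite unlock; exact: tactM. Qed.
Lemma act1 U : act U 1 = 1 :> T.
Proof. by rewrite unlock; exact: tact1. Qed.
Lemma act_lin U : @lin C n T (act U).
Proof. exact: actP. Qed.

Lemma starE z s t : (star z)@_(bw s t) = (z@_(bw (rev t) (rev s)))^*.
Proof. by rewrite unlock tstarE. Qed.
Lemma starP a x y : star (a *: x + y) = a^* *: star x + star y :> T.
Proof. by rewrite unlock tstarD tstarZ. Qed.
Lemma star_eb s t : star (eb C s t) = eb C (rev t) (rev s).
Proof. by rewrite !unlock; exact: tstar_tbasis. Qed.
Lemma starK : involutive (@star C n).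
Proof. by move=> z; rewrite unlock tstarK. Qed.

Lemma contrP i j a x y : contr i j (a *: x + y) = a *: contr i j x + contr i j y.
Proof. by rewrite unlock; exact: linextP. Qed.
Lemma contr_lin i j : @lin C n T (contr i j).
Proof. exact: contrP. Qed.
Lemma contr_eb i j u v : contr i j (eb C u v) =
  if onth u i == onth v j then eb C (del_nth i u) (del_nth j v) else 0.
Proof. by rewrite !unlock contraction_tbasis. Qed.

Lemma projP k l a x y : proj k l (a *: x + y) = a *: proj k l x + proj k l y.
Proof. by rewrite unlock; exact: linextP. Qed.
Lemma proj_eb k l s t : proj k l (eb C s t) =
  if (size s == k) && (size t == l) then eb C s t else 0.
Proof. by rewrite !unlock linext_tbasis. Qed.
Lemma proj_lin k l : @lin C n T (proj k l).
Proof. exact: projP. Qed.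

Lemma tensorP x y : (forall s t, x@_(bw s t) = y@_(bw s t)) <-> x = y.
Proof.
split=> [xy|-> //]; apply/malgP => m; rewrite (bwE m); exact: xy.
Qed.

Lemma tensor_ext (E : lmodType C) (f g : T -> E) : lin f -> lin g ->
  (forall s t, f (eb C s t) = g (eb C s t)) -> f =1 g.
Proof.
move=> fP gP fg; apply: lin_ext => // m; rewrite tbasisE; exact: fg.
Qed.

Lemma tensor_ind (P : T -> Prop) :
  P 0 -> (forall a s t y, P y -> P (a *: eb C s t + y)) -> forall z, P z.
Proof.
move=> P0 PS; apply: mtensor_ind => // a m y Py; rewrite tbasisE; exact: PS.
Qed.

End Sealed.

(** * The action on homogeneous tensors *)

Section Action.
Variables (C : numClosedFieldType) (n : nat).
Local Notation T := (mtensor C n).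
Implicit Types (U W : 'M[C]_n) (x y z : T) (s t u v : seq 'I_n).

Lemma act_id z : act 1%:M z = z.
Proof.
move: z; apply: tensor_ext => [||u v]; [exact: act_lin|by move=> ?|].
apply/tensorP => s t; rewrite coef_act_eb trmx1 invmx1 !kron1.
by rewrite coef_eb -mulnb natrM ![in RHS](eq_sym _ s) (eq_sym _ t).
Qed.

Lemma invmx_mul U W : U \in unitmx -> W \in unitmx ->
  invmx (U *m W) = invmx W *m invmx U.
Proof.
move=> Uu Wu; have UWu : U *m W \in unitmx by rewrite unitmx_mul Uu.
rewrite -[RHS](mulmxK UWu) mulmxA -(mulmxA _ _ U) mulVmx // mulmx1.
by rewrite mulVmx // mul1mx.
Qed.

Lemma act_comp U W z : U \in unitmx -> W \in unitmx ->
  act (U *m W) z = act U (act W z).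
Proof.
move=> Uu Wu; move: z; apply: tensor_ext => [||u v].
- exact: act_lin.
- by move=> a x y; rewrite !actP.
apply/tensorP => s t; rewrite coef_act_eb actE.
have -> : invmx (U *m W)^T = invmx U^T *m invmx W^T.
  by rewrite trmx_mul invmx_mul // unitmx_tr.
rewrite (kron_mul _ _ _ (erefl (size s))) (kron_mul _ _ _ (erefl (size t))).
rewrite big_distrlr /=; apply: eq_bigr => s' _; apply: eq_bigr => t' _.
by rewrite coef_act_eb mulrACA.
Qed.

Lemma actK U z : U \in unitmx -> act (invmx U) (act U z) = z.
Proof. by move=> Uu; rewrite -act_comp ?unitmx_inv // mulVmx // act_id. Qed.

(** The star turns vectors into covectors, hence U into its contragredient, and
    conjugates.  This is why T^G is closed under star when G = G^*, and it makes
    star commute with unitary matrices. *)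
Lemma star_act U z :
  star (act U z) = act (invmx (U ^t*)%sesqui) (star z).
Proof.
rewrite -{1}(starK z); move: (star z); apply: tensor_ext => [a x y||u v].
- by rewrite starP actP starP conjCK.
- exact: act_lin.
apply/tensorP => s t; rewrite star_eb [LHS]starE !coef_act_eb.
rewrite rmorphM /= -!kron_conj.
rewrite !kron_rev mulrC; congr (_ * _).
  by rewrite map_invmx.
by rewrite -trmx_inv invmxK -map_trmx trmxK.
Qed.

Lemma bidegreeP k l z : bidegree k l z <->
  forall s t, z@_(bw s t) != 0 -> size s = k /\ size t = l.
Proof.
split=> [zkl s t|zkl m].
  by rewrite mcoeff_neq0 => /zkl.
by rewrite (bwE m) -mcoeff_neq0 => /zkl.
Qed.

Lemma bidegree_coef0 k l z s t : bidegree k l z ->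
  (size s != k) || (size t != l) -> z@_(bw s t) = 0.
Proof.
move=> /bidegreeP zkl; have [//|/zkl [-> ->]] := eqVneq (z@_(bw s t)) 0.
by rewrite !eqxx.
Qed.

Lemma bidegree_ind k l (P : T -> Prop) :
  P 0 -> (forall a s t y, size s = k -> size t = l -> P y ->
    P (a *: eb C s t + y)) -> forall z, bidegree k l z -> P z.
Proof.
move=> P0 PS z zkl; rewrite [z]mtensorE.
have : {subset (msupp z : seq _) <= msupp z} by [].
elim: {1 2}(msupp z : seq _) => [|m r IH] rz; first by rewrite big_nil.
rewrite big_cons tbasisE.
have [sk tl] := zkl m (rz m (mem_head _ _)).
by apply: PS => //; apply: IH => p pr; apply: rz; rewrite inE pr orbT.
Qed.

(** The working principle for identities that hold in one bidegree only, such
    as those about contractions. *)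
Lemma bidegree_ext (E : lmodType C) k l (f g : T -> E) : lin f -> lin g ->
  (forall s t, size s = k -> size t = l -> f (eb C s t) = g (eb C s t)) ->
  forall z, bidegree k l z -> f z = g z.
Proof.
move=> fP gP fg; apply: bidegree_ind => [|a s t y sk tl IH].
  by rewrite (lin0 fP) (lin0 gP).
by rewrite fP gP IH fg.
Qed.

Lemma bidegree_eb s t : bidegree (size s) (size t) (eb C s t).
Proof.
apply/bidegreeP => s' t'; rewrite coef_eb.
by case: andP => [[/eqP -> /eqP ->]//|]; rewrite eqxx.
Qed.

Lemma bidegreeD k l a x y : bidegree k l x -> bidegree k l y -> bidegree k l (a *: x + y).
Proof.
move=> xk yk; apply/bidegreeP => s t.
rewrite tcoefD tcoefZ.
have [x0 H|/((bidegreeP _ _ _).1 xk)//] := eqVneq (x@_(bw s t)) 0.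
apply: ((bidegreeP _ _ _).1 yk); move: H; by rewrite x0 mulr0 add0r.
Qed.

Lemma bidegree0 k l : bidegree k l (0 : T).
Proof. by apply/bidegreeP => s t; rewrite mcoeff0 eqxx. Qed.

Lemma act_bidegree U k l z : bidegree k l z -> bidegree k l (act U z).
Proof.
move=> zkl; apply/bidegreeP => s t; rewrite actE => H.
suff /andP[/eqP -> /eqP ->] : (size s == k) && (size t == l) by [].
apply: contraNT H; rewrite negb_and => H.
rewrite big1 // => s' _; rewrite big1 // => t' _.
by rewrite (bidegree_coef0 zkl) ?mulr0 // !size_tuple.
Qed.

Lemma star_bidegree k l z : bidegree k l z -> bidegree l k (star z).
Proof.
move=> zkl; apply/bidegreeP => s t; rewrite starE conjC_eq0.
by move=> /((bidegreeP _ _ _).1 zkl); rewrite !size_rev => -[].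
Qed.

Lemma mul_bidegree k l k' l' x y : bidegree k l x -> bidegree k' l' y ->
  bidegree (k + k') (l + l') (x * y).
Proof.
move=> xk yk; move: x xk; apply: bidegree_ind => [|a s t x <- <- IH].
  by rewrite mul0r; apply: bidegree0.
rewrite tmulDl; apply: bidegreeD; last exact: IH.
move=> {x IH}.
move: y yk; apply: bidegree_ind => [|b s' t' y <- <- IH].
  by rewrite mulr0; apply: bidegree0.
rewrite tmulDr; apply: bidegreeD; last exact: IH.
rewrite eb_mul -!size_cat; exact: bidegree_eb.
Qed.

Lemma bidegree1 : bidegree 0 0 (1 : T).
Proof. rewrite one_eb; exact: bidegree_eb. Qed.

Lemma coef_proj k l z s t : (proj k l z)@_(bw s t) =
  if (size s == k) && (size t == l) then z@_(bw s t) else 0.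
Proof.
move: z; apply: (@tensor_ext _ _ C^o _ (fun z => if _ then z@_(bw s t) else 0)).
- move=> a x y; rewrite projP; exact: coef_is_lin.
- by move=> a x y; case: ifP => _; [exact: coef_is_lin|rewrite scaler0 addr0].
move=> u v; rewrite proj_eb; case: ifP => H; rewrite ?mcoeff0 coef_eb.
  case: andP => [[/eqP <- /eqP <-]|]; first by rewrite H.
  by case: ifP.
case: ifP => // /andP[/eqP sk /eqP tl]; case: andP => // -[/eqP ms /eqP mt].
by rewrite ms mt sk tl !eqxx in H.
Qed.

Lemma proj_bidegree k l z : bidegree k l (proj k l z).
Proof.
by apply/bidegreeP => s t; rewrite coef_proj; case: andP => [[/eqP -> /eqP ->]|]; rewrite ?eqxx.
Qed.

Lemma proj_id k l z : bidegree k l z -> proj k l z = z.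
Proof.
move=> zkl; apply/tensorP => s t; rewrite coef_proj.
case: ifPn => //; rewrite negb_and => H; by rewrite (bidegree_coef0 zkl).
Qed.

Lemma proj_other k l k' l' z : bidegree k' l' z -> (k, l) != (k', l') -> proj k l z = 0.
Proof.
move=> zkl kl; apply/tensorP => s t; rewrite coef_proj mcoeff0.
case: ifP => // /andP[/eqP sk /eqP tl]; rewrite (bidegree_coef0 zkl) //.
by rewrite -negb_and sk tl.
Qed.

Lemma act_proj U k l z : act U (proj k l z) = proj k l (act U z).
Proof.
apply/tensorP => s t; rewrite [RHS]coef_proj [LHS]actE [in RHS]actE; case: ifP => H; last first.
  by rewrite big1 // => s' _; rewrite big1 // => t' _; rewrite coef_proj !size_tuple H mulr0.
by apply: eq_bigr => s' _; apply: eq_bigr => t' _; rewrite coef_proj !size_tuple H.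
Qed.

(** The support is finite, so a tensor has finitely many homogeneous components. *)
Lemma tensor_bound z : exists d, forall s t, z@_(bw s t) != 0 ->
  (size s < d)%N && (size t < d)%N.
Proof.
move: z; apply: tensor_ind => [|a u v y [d0 Hd]].
  by exists 0%N => s t; rewrite mcoeff0 eqxx.
exists (maxn d0 (maxn (size u) (size v)).+1) => s t.
rewrite tcoefD tcoefZ coef_eb.
case: andP => [[/eqP <- /eqP <-] _|_].
  by rewrite !leq_max !ltnS !leq_max !leqnn !orbT.
rewrite mulr0 add0r => /Hd /andP[sd td].
by rewrite !leq_max sd td.
Qed.

Lemma proj_sum z : exists d0, forall d, (d0 <= d)%N ->
  z = \sum_(k < d) \sum_(l < d) proj k l z.
Proof.
have [d0 Hd0] := tensor_bound z; exists d0 => d d0d.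
apply/tensorP => s t; rewrite tcoef_sum.
under eq_bigr => k _ do rewrite tcoef_sum.
under eq_bigr => k _ do under eq_bigr => l _ do rewrite coef_proj.
have [->|/Hd0/andP[sd td]] := eqVneq (z@_(bw s t)) 0.
  by rewrite big1 // => k _; rewrite big1 // => l _; case: ifP.
rewrite (bigD1 (Ordinal (leq_trans sd d0d))) //= [X in _ = X + _](bigD1 (Ordinal (leq_trans td d0d))) //=.
rewrite !eqxx /= !big1 ?addr0 // => [k kd|l ld].
  rewrite big1 // => l _; case: ifP => // /andP[/eqP sk _].
  by case/eqP: kd; apply: val_inj.
case: ifP => // /eqP tl.
by case/eqP: ld; apply: val_inj.
Qed.

End Action.

(** * Contractions commute with the action *)

Section Contraction.
Variables (C : numClosedFieldType) (n : nat).
Local Notation T := (mtensor C n).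
Implicit Types (U W : 'M[C]_n) (x y z : T) (s t u v : seq 'I_n).

(** Inserting a letter at position i undoes del_nth i; it indexes the words that
    a contraction sends to a given word. *)
Definition ins i (a : 'I_n) s := take i s ++ a :: drop i s.

Lemma size_ins i a s : size (ins i a s) = (size s).+1.
Proof. by rewrite size_cat /= addnS -size_cat cat_take_drop. Qed.

Lemma del_ins i a s : (i <= size s)%N -> del_nth i (ins i a s) = s.
Proof.
move=> si; rewrite /del_nth /ins take_size_cat ?size_takel //.
rewrite -cat_rcons drop_size_cat ?cat_take_drop // size_rcons size_takel //.
Qed.

Lemma onth_ins i a s : (i <= size s)%N -> onth (ins i a s) i = Some a.
Proof.
move=> si; rewrite /ins; apply/eqP; rewrite onthE map_cat nth_cat size_map size_takel // ltnn subnn //.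
Qed.

Lemma insP i u : (i < size u)%N -> exists a s, u = ins i a s /\ (i <= size s)%N.
Proof.
move=> iu; case E : (drop i u) => [|a r].
  by move: (size_drop i u); rewrite E /= => /esym/eqP; rewrite subn_eq0 leqNgt iu.
exists a, (take i u ++ r); rewrite /ins take_size_cat ?size_takel ?(ltnW iu) //.
rewrite drop_size_cat ?size_takel ?(ltnW iu) // -E cat_take_drop; split=> //.
by rewrite size_cat size_takel ?(ltnW iu) // leq_addr.
Qed.

Lemma kron_ins M i a b s t : (i <= size s)%N -> (i <= size t)%N ->
  kron M (ins i a s) (ins i b t) = M a b * kron M s t :> C.
Proof.
move=> si ti; rewrite /ins kron_cat ?size_takel //= mulrCA -kron_cat ?size_takel //.
by rewrite !cat_take_drop.
Qed.

Lemma contr_ins i j a b s t : (i <= size s)%N -> (j <= size t)%N ->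
  contr i j (eb C (ins i a s) (ins j b t)) = (a == b)%:R *: eb C s t.
Proof.
move=> si tj; rewrite contr_eb !onth_ins // !del_ins //.
rewrite (inj_eq Some_inj); case: eqP => _; by rewrite ?scale1r ?scale0r.
Qed.

Lemma contr_ind k l i j (P : T -> Prop) : (i < k)%N -> (j < l)%N ->
  P 0 -> (forall c a b s t y, size s = k.-1 -> size t = l.-1 ->
   (i <= size s)%N -> (j <= size t)%N -> P y ->
    P (c *: eb C (ins i a s) (ins j b t) + y)) -> forall z, bidegree k l z -> P z.
Proof.
move=> ik jl P0 PS; apply: bidegree_ind => // c u v y uk vl Py.
have iu : (i < size u)%N by rewrite uk.
have jv : (j < size v)%N by rewrite vl.
have [a [s [us si]]] := insP iu; have [b [t [vt tj]]] := insP jv.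
rewrite us vt; apply: PS => //.
  by rewrite -uk us size_ins.
by rewrite -vl vt size_ins.
Qed.

Lemma contr_bidegree k l i j z : (i < k)%N -> (j < l)%N ->
  bidegree k l z -> bidegree k.-1 l.-1 (contr i j z).
Proof.
move=> ik jl; move: z; apply: (contr_ind ik jl).
  by rewrite (lin0 (@contr_lin C n i j)); apply: bidegree0.
move=> c a b s t y sk tl si tj IH; rewrite contrP contr_ins //.
apply: bidegreeD IH; rewrite -(addr0 (_ *: _)); apply: bidegreeD; last exact: bidegree0.
rewrite -sk -tl; exact: bidegree_eb.
Qed.

Lemma coef_contr k l i j z s t : (i < k)%N -> (j < l)%N ->
  bidegree k l z -> size s = k.-1 -> size t = l.-1 ->
  (contr i j z)@_(bw s t) = \sum_a z@_(bw (ins i a s) (ins j a t)).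
Proof.
move=> ik jl zkl sk tl; move: z zkl.
have si : (i <= size s)%N by rewrite sk; case: (k) ik.
have tj : (j <= size t)%N by rewrite tl; case: (l) jl.
have ins_eq i' a b s' t' : (i' <= size s')%N -> (i' <= size t')%N ->
   (ins i' a s' == ins i' b t') = (a == b) && (s' == t').
  move=> H1 H2; apply/eqP/andP => [E|[/eqP -> /eqP ->]//]; split; apply/eqP.
    by apply: Some_inj; rewrite -(onth_ins a H1) -(onth_ins b H2) E.
  by rewrite -(del_ins a H1) -(del_ins b H2) E.
apply: (contr_ind ik jl).
  by rewrite (lin0 (@contr_lin C n i j)) mcoeff0 big1 // => a _; rewrite mcoeff0.
move=> c a b s' t' y s'k t'l si' tj' IH.
rewrite contrP contr_ins // tcoefD tcoefZ tcoefZ coef_eb IH.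
under [RHS]eq_bigr => d _ do rewrite tcoefD tcoefZ coef_eb !ins_eq //.
rewrite big_split /= -mulr_sumr; congr (_ * _ + _).
rewrite (bigD1 a) //= eqxx big1 ?addr0 /= => [|d /negPf da]; last by rewrite eq_sym da.
by rewrite [b == a]eq_sym; case: (a == b) => /=; rewrite ?andbF ?mul1r ?mul0r.
Qed.

(** A contraction sums over equal letters in the two contracted places, and
    the sum over a of (U a b) * (U^-T a c) is the identity matrix. *)
Lemma act_contr U k l i j z : U \in unitmx -> (i < k)%N -> (j < l)%N ->
  bidegree k l z -> contr i j (act U z) = act U (contr i j z).
Proof.
move=> Uu ik jl; move: z; apply: (@bidegree_ext C n T k l).
- by move=> c x y; rewrite actP contrP.
- by move=> c x y; rewrite contrP actP.
move=> s t sk tl.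
have iu : (i < size s)%N by rewrite sk.
have jv : (j < size t)%N by rewrite tl.
have [a [u [us ui]]] := insP iu; have [b [v [vt vj]]] := insP jv.
rewrite us vt contr_ins // (linZ (@act_lin C n U)).
have uk : size u = k.-1 by rewrite -sk us size_ins.
have vl : size v = l.-1 by rewrite -tl vt size_ins.
move: {s t us vt sk tl iu jv}ik jl => ik jl.
have kE : k = (size (ins i a u)) by rewrite size_ins uk; case: (k) ik.
have lE : l = (size (ins j b v)) by rewrite size_ins vl; case: (l) jl.
have zkl : bidegree k l (act U (eb C (ins i a u) (ins j b v))).
  by apply: act_bidegree; rewrite kE lE; apply: bidegree_eb.
apply/tensorP => s t; rewrite tcoefZ coef_act_eb.
have [/andP[/eqP sk /eqP tl]|] := boolP ((size s == k.-1) && (size t == l.-1)); last first.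
  rewrite negb_and => H; rewrite (bidegree_coef0 (contr_bidegree ik jl zkl)) //.
  rewrite -uk -vl in H; by case/orP: H => /kron_size ->; rewrite ?mul0r ?mulr0.
rewrite (coef_contr ik jl zkl) //.
have si : (i <= size s)%N by rewrite sk -uk.
have tj : (j <= size t)%N by rewrite tl -vl.
under eq_bigr => d _ do rewrite coef_act_eb !kron_ins // mulrACA.
rewrite -mulr_suml; congr (_ * _).
have := congr1 (fun M : 'M_n => M a b) (mulmxV (etrans (unitmx_tr U) Uu)).
rewrite !mxE => <-; apply: eq_bigr => d _; by rewrite mxE.
Qed.

(** I is the identity endomorphism of V, and U * 1 * U^-1 = 1. *)
Lemma act_tensI U : U \in unitmx -> act U tensI = tensI :> T.
Proof.
move=> Uu; apply/tensorP => s t.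
have IE s' t' : (tensI : T)@_(bw s' t') = ((size s' == 1%N) && (s' == t'))%:R.
  rewrite /tensI tcoef_sum; under eq_bigr => i _ do
    rewrite e_bw estar_bw tbasis_mul coef_tbasis bw_eq /=.
  case: s' => [|a [|b s']] /=; first by rewrite big1.
    2: by rewrite big1 // => i _; rewrite eqseq_cons andbF.
  rewrite (bigD1 a) //= eqxx big1 ?addr0 /= => [|i /negPf ia].
    by rewrite eq_sym.
  by rewrite eqseq_cons ia.
rewrite actE IE.
under eq_bigr => s' _ do under eq_bigr => t' _ do rewrite IE size_tuple.
have [s1|s1] := boolP (size s == 1%N); last by rewrite big1 // => s' _; rewrite big1 // => t' _; rewrite mulr0.
rewrite /=; under eq_bigr => s' _.
  rewrite (big_tuple_pick _ s' (fun t' => kron U s s' * kron (invmx U^T) t t')).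
  over.
under eq_bigr => s' _ do rewrite size_tuple.
have [st|st] := eqVneq (size s) (size t); last first.
  rewrite big1 //.
  by have [st'|//] := eqVneq s t; rewrite st' eqxx in st.
rewrite /= -kron1.
rewrite -(mulmxV Uu) (kron_mul _ _ _ (erefl (size s))).
apply: eq_bigr => s' _; by rewrite -trmx_inv kron_tr.
Qed.

End Contraction.

(** * The Hermitian inner product and the closed algebras *)

(** The Hermitian product for which words are orthonormal, linear on the left. *)
HB.lock Definition ip (C : numClosedFieldType) (n : nat) (x y : mtensor C n) : C :=
  mmap idfun (fun m => (y@_m)^* ) x.

Section InnerProduct.
Variables (C : numClosedFieldType) (n : nat).
Local Notation T := (mtensor C n).
Implicit Types (U W : 'M[C]_n) (x y z : T) (s t u v : seq 'I_n).

Lemma ipE x y : ip x y = \sum_(m <- msupp x) x@_m * (y@_m)^*.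
Proof. by rewrite unlock mmapE. Qed.

Lemma ipPl a x x' y : ip (a *: x + x') y = a * ip x y + ip x' y.
Proof.
rewrite unlock mmapD (mmapEw (msuppZ_le _ _)) mmapE mulr_sumr.
by congr (_ + _); apply: eq_bigr => m _; rewrite /= tcoefZ mulrA.
Qed.

Lemma ip_linl y : @lin C n C^o (fun x => ip x y).
Proof. by move=> a x x'; rewrite ipPl. Qed.

Lemma ip_ebl s t y : ip (eb C s t) y = (y@_(bw s t))^*.
Proof. by rewrite !unlock /tbasis mmapU mul1r. Qed.

Lemma ipC x y : ip y x = (ip x y)^*.
Proof.
suff -> : ip x y = (ip y x)^* by rewrite conjCK.
move: x; apply: (@tensor_ext _ _ C^o _ (fun x => (ip y x)^*)).
- exact: ip_linl.
- move=> a x x'; suff -> : ip y (a *: x + x') = a^* * ip y x + ip y x'.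
    by rewrite rmorphD rmorphM /= conjCK.
  move: y; apply: (@tensor_ext _ _ C^o _ (fun y => a^* * ip y x + ip y x')).
  + exact: ip_linl.
  + by move=> b y y'; rewrite !ipPl mulrDr mulrCA addrACA scalerDr.
  by move=> s t; rewrite !ip_ebl tcoefD tcoefZ rmorphD rmorphM.
move=> s t; rewrite ip_ebl; congr (_^*).
move: y; apply: (@tensor_ext _ _ C^o).
- exact: coef_is_lin.
- exact: ip_linl.
by move=> u v; rewrite coef_eb ip_ebl coef_eb conjC_nat [in RHS]eq_sym [v == t]eq_sym.
Qed.

Lemma ip_ebr s t x : ip x (eb C s t) = x@_(bw s t).
Proof. by rewrite ipC ip_ebl conjCK. Qed.

Lemma ipPr a x y y' : ip x (a *: y + y') = a^* * ip x y + ip x y'.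
Proof. by rewrite [LHS]ipC ipPl rmorphD rmorphM /= (ipC y x) (ipC y' x). Qed.

Lemma ip0l y : ip 0 y = 0.
Proof. exact: lin0 (ip_linl y). Qed.
Lemma ip0r x : ip x 0 = 0.
Proof. by rewrite ipC ip0l rmorph0. Qed.

Lemma unitary_unit U : U \is unitarymx -> U \in unitmx.
Proof. exact: unitarymx_unit. Qed.

Lemma unitary_inv U : U \is unitarymx -> invmx U \is unitarymx.
Proof. by move=> Uu; rewrite invmx_unitary // trmxC_unitary. Qed.

Lemma unitary_invT U : U \is unitarymx -> invmx U^T = map_mx Num.conj U.
Proof. by move=> Uu; rewrite -trmx_inv invmx_unitary // -map_trmx trmxK. Qed.

Lemma unitary1 : (1%:M : 'M[C]_n) \is unitarymx.
Proof. by apply/unitarymxP; rewrite mul1mx trmx1 map_mx1. Qed.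

(** Kronecker powers of a unitary matrix are unitary. *)
Lemma ip_act U x y : U \is unitarymx -> ip (act U x) y = ip x (act (invmx U) y).
Proof.
move=> Uu; move: x; apply: (@tensor_ext _ _ C^o).
- by move=> a x x'; rewrite actP ipPl.
- exact: ip_linl.
move=> s t; rewrite ip_ebl ipC; congr (_^*).
move: y; apply: (@tensor_ext _ _ C^o).
- exact: ip_linl.
- by move=> a x x'; rewrite actP; apply: coef_is_lin.
move=> u v; rewrite ip_ebl !coef_act_eb rmorphM /= -!kron_conj; congr (_ * _).
  by rewrite invmx_unitary // -[RHS]kron_tr map_trmx trmxK.
by rewrite unitary_invT // -trmx_inv invmxK kron_tr -map_mx_comp map_mx_id // => a /=; rewrite conjCK.
Qed.

Lemma ip_act2 U x y : U \is unitarymx -> ip (act U x) (act U y) = ip x y.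
Proof. by move=> Uu; rewrite ip_act // actK // unitary_unit. Qed.

Lemma ip_ge0 x : 0 <= ip x x.
Proof. by rewrite ipE; apply: sumr_ge0 => m _; rewrite mul_conjC_ge0. Qed.

Lemma ip_coef_le x s t : `|x@_(bw s t)| ^+ 2 <= ip x x.
Proof.
rewrite normCK ipE; have [xs|xs] := boolP (bw s t \in msupp x).
  rewrite (big_fsetD1 _ xs) /= lerDl; apply: sumr_ge0 => m _; by rewrite mul_conjC_ge0.
rewrite mcoeff_outdom // mul0r; apply: sumr_ge0 => m _; by rewrite mul_conjC_ge0.
Qed.

Lemma ip_eq0 x : ip x x = 0 -> x = 0.
Proof.
move=> x0; apply/tensorP => s t; rewrite mcoeff0.
have := ip_coef_le x s t; rewrite x0 => H.
by apply/eqP; rewrite -normr_eq0 -sqrf_eq0 eq_le H exprn_ge0.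
Qed.

Lemma coef_star_rev x s t : (star x)@_(bw (rev t) (rev s)) = (x@_(bw s t))^*.
Proof. by rewrite starE !revK. Qed.

Lemma ip_star x y : ip (star x) (star y) = ip y x.
Proof.
move: y; apply: (@tensor_ext _ _ C^o).
- by move=> a y y'; rewrite starP ipPr conjCK.
- exact: ip_linl.
move=> s t; by rewrite star_eb ip_ebr ip_ebl coef_star_rev.
Qed.

(** The left factors must have the same bidegree: a product of inhomogeneous
    tensors can reach the same word through different splittings. *)
Lemma ip_mul k l x x' y y' : bidegree k l x -> bidegree k l x' ->
  ip (x * y) (x' * y') = ip x x' * ip y y'.
Proof.
move=> xk xk'; move: x xk; apply: (@bidegree_ext _ _ C^o).
- by move=> a u v; rewrite tmulDl ipPl.
- by move=> a u v; rewrite ipPl mulrDl -mulrA.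
move=> s t sk tl; rewrite [LHS]ipC [in RHS]ipC -[ip y y']conjCK -rmorphM; congr (_^*).
rewrite -ipC; move: x' xk'; apply: (@bidegree_ext _ _ C^o).
- by move=> a u v; rewrite tmulDl ipPl.
- by move=> a u v; rewrite ipPl mulrDl -mulrA.
move=> s' t' sk' tl'; move: y'; apply: (@tensor_ext _ _ C^o).
- by move=> a u v; rewrite tmulDr ipPl.
- by move=> a u v; rewrite ipPl mulrDr mulrCA.
move=> u v; rewrite eb_mul !ip_ebl.
rewrite -rmorphM; congr (_^*).
move: y; apply: (@tensor_ext _ _ C^o).
- by move=> a y y'; rewrite tmulDr; apply: coef_is_lin.
- move=> a y y'; rewrite (coef_is_lin (bw u v)) mulrDr; congr (_ + _); exact: mulrCA.
move=> u' v'; rewrite eb_mul !coef_eb -natrM mulnb.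
by rewrite !eqseq_cat ?sk ?tl // andbACA.
Qed.

Lemma trmxC_inv U : invmx (U ^t*)%sesqui = (invmx U ^t*)%sesqui.
Proof. by rewrite -map_invmx trmx_inv. Qed.

End InnerProduct.

Section Algebras.
Variables (C : numClosedFieldType) (n : nat).
Local Notation T := (mtensor C n).
Implicit Types (U W : 'M[C]_n) (x y z : T) (s t u v : seq 'I_n) (A : set T).

(** The conditions on A in the form in which they are used: gradedness becomes
    closure under homogeneous components. *)
Record ccalg A : Prop := CCAlg {
  cc1 : A 1;
  ccP : forall a x y, A x -> A y -> A (a *: x + y);
  ccM : forall x y, A x -> A y -> A (x * y);
  cc_proj : forall k l z, A z -> A (proj k l z);
  cc_star : forall z, A z -> A (star z);
  cc_contr : forall k l i j z, (i < k)%N -> (j < l)%N -> bidegree k l z ->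
     A z -> A (contr i j z) }.

Lemma ccalgP A : contraction_closed_graded_star_subalgebra A <-> ccalg A.
Proof.
have A0 : (forall a x y, A x -> A y -> A (a *: x + y)) -> A 1 -> A 0.
  by move=> AP A1; rewrite -(addNr (1 : T)) -scaleN1r; exact: AP.
split=> [[[A1 AP AM] grA stA coA]|[A1 AP AM Apr Ast Aco]].
  split=> //.
  - move=> k l z /grA [d [y [yA ->]]].
    have {A0}A0 := A0 AP A1.
    have AD x x' : A x -> A x' -> A (x + x') by move=> *; rewrite -[x]scale1r; exact: AP.
    have pD x x' : proj k l (x + x') = proj k l x + proj k l x' :> T.
      by rewrite -[x]scale1r projP !scale1r.
    have p0 : proj k l 0 = 0 :> T by exact: lin0 (@proj_lin C n k l).
    rewrite (big_morph _ pD p0); apply: (big_ind A) => // i _.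
    rewrite (big_morph _ pD p0); apply: (big_ind A) => // j _.
    have [Ay yij] := yA i j.
    have [E|] := eqVneq (k, l) (i : nat, j : nat); last by move/(proj_other yij) => ->.
    by case: E => -> ->; rewrite proj_id.
  - by move=> z Az; rewrite unlock -stA; exists z.
  - by move=> k l i j z ik jl zkl Az; rewrite unlock; apply: (coA k l).
split=> //.
- move=> z; split=> [Az|[d [y [yA ->]]]].
    have [d /(_ d (leqnn d)) zE] := proj_sum z.
    exists d, (fun k l => proj k l z); split=> // k l; split; [exact: Apr|exact: proj_bidegree].
  have AD x x' : A x -> A x' -> A (x + x') by move=> *; rewrite -[x]scale1r; exact: AP.
  apply: (big_ind A) => [||i _] //; first exact: A0.
  apply: (big_ind A) => [||j _] //; first exact: A0.
  by case: (yA i j).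
- apply/seteqP; split=> [_ [z Az <-]|z Az].
    by have := Ast _ Az; rewrite unlock.
  by exists (star z); [exact: Ast|have := starK z; rewrite [star]unlock].
- by move=> k l i j ik jl z [Az zkl]; have := Aco k l i j z ik jl zkl Az; rewrite unlock.
Qed.

Lemma cc0 A : ccalg A -> A 0.
Proof. by case=> A1 AP *; rewrite -(addNr (1 : T)) -scaleN1r; exact: AP. Qed.

Lemma ccD A x y : ccalg A -> A x -> A y -> A (x + y).
Proof. by move=> /ccP AP xA yA; rewrite -[x]scale1r; exact: AP. Qed.

Lemma cc_of_proj A z : ccalg A -> (forall k l, A (proj k l z)) -> A z.
Proof.
move=> cA H; have [d /(_ d (leqnn d)) ->] := proj_sum z.
apply: (big_ind A) => [||i _] //; [exact: cc0|by move=> *; apply: ccD|].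
by apply: (big_ind A) => [||j _] //; [exact: cc0|by move=> *; apply: ccD].
Qed.

Lemma invariantsE (G : set 'M[C]_n) z : invariants G z <-> (forall U, G U -> act U z = z).
Proof. by rewrite unlock. Qed.

Lemma invariants_ccalg (G : set 'M[C]_n) : star_subgroup G -> ccalg (invariants G).
Proof.
move=> [[GGL G1 GM GV] Gst]; split.
- by apply/invariantsE => U _; exact: act1.
- by move=> a x y /invariantsE xG /invariantsE yG; apply/invariantsE => U GU; rewrite actP (xG _ GU) (yG _ GU).
- by move=> x y /invariantsE xG /invariantsE yG; apply/invariantsE => U GU; rewrite actM (xG _ GU) (yG _ GU).
- by move=> k l z /invariantsE zG; apply/invariantsE => U GU; rewrite act_proj zG.
- move=> z /invariantsE zG; apply/invariantsE => U GU.
  have GUs : G (U ^t*)%sesqui by rewrite -Gst; exists U.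
  rewrite -[in RHS](zG _ (GV _ GUs)) star_act.
  have -> : invmx ((invmx (U ^t*)%sesqui) ^t*)%sesqui = U; last by [].
  by rewrite -trmxC_inv invmxK map_trmx trmxK -map_mx_comp map_mx_id // => a /=; rewrite conjCK.
move=> k l i j z ik jl zkl /invariantsE zG; apply/invariantsE => U GU.
by rewrite -(act_contr (GGL _ GU) ik jl zkl) (zG _ GU).
Qed.

Lemma invariants_tensI (G : set 'M[C]_n) : G `<=` GL -> invariants G tensI.
Proof. by move=> GGL; apply/invariantsE => U /GGL; exact: act_tensI. Qed.

End Algebras.

(** * Adjoints of multiplications and permuted powers of I *)

Section Closure.
Variables (C : numClosedFieldType) (n : nat).
Local Notation T := (mtensor C n).
Implicit Types (U W : 'M[C]_n) (x y z : T) (s t u v : seq 'I_n) (A : set T).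

Lemma ins_cat i a s t : i = size s -> ins i a (s ++ t) = s ++ a :: t.
Proof. by move=> ->; rewrite /ins take_size_cat // drop_size_cat. Qed.

Lemma contr_cat i j a b s t s' t' : i = size s -> j = size s' ->
  contr i j (eb C (s ++ a :: t) (s' ++ b :: t')) = (a == b)%:R *: eb C (s ++ t) (s' ++ t').
Proof.
move=> si sj; rewrite -(ins_cat a t si) -(ins_cat b t' sj) contr_ins //.
  by rewrite si size_cat leq_addr.
by rewrite sj size_cat leq_addr.
Qed.

(** contrV m p pairs the V-factors m-1, ..., 0 in this order with the V^*-factors
    p, p+1, ..., and contrW m pairs the V-factors 0, 1, ... with the V^*-factors
    m-1, ..., 0.  Star reverses words, so that these are the pairings that match
    the factors of star b with the leading factors of a in (star b) * a. *)
Fixpoint contrV m p x : T := if m is m'.+1 then contrV m' p (contr m' p x) else x.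
Fixpoint contrW m x : T := if m is m'.+1 then contrW m' (contr 0 m' x) else x.

Lemma contrV_lin m p : @lin C n T (contrV m p).
Proof. by elim: m => [|m IH] a x y //=; rewrite contrP IH. Qed.
Lemma contrW_lin m : @lin C n T (contrW m).
Proof. by elim: m => [|m IH] a x y //=; rewrite contrP IH. Qed.

Lemma contrV_eb m p r r' s u v : size r = m -> size r' = m -> size s = p ->
  contrV m p (eb C (rev r ++ u) (s ++ r' ++ v)) = (r == r')%:R *: eb C u (s ++ v).
Proof.
elim: m r r' u => [|m IH] [|a r] [|a' r'] u //=; first by rewrite scale1r.
move=> [rm] [r'm] sp; rewrite rev_cons cat_rcons contr_cat ?size_rev //.
rewrite (linZ (@contrV_lin m p)) (IH _ _ _ rm r'm sp) scalerA eqseq_cons.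
by case: (a == a'); rewrite ?mul1r ?mul0r.
Qed.

Lemma contrW_eb m r r' u v : size r = m -> size r' = m ->
  contrW m (eb C (r' ++ u) (rev r ++ v)) = (r == r')%:R *: eb C u v.
Proof.
elim: m r r' u => [|m IH] [|a r] [|a' r'] u //=; first by rewrite scale1r.
move=> [rm] [r'm]; rewrite rev_cons cat_rcons (@contr_cat _ _ _ _ [::]) ?size_rev //=.
rewrite (linZ (@contrW_lin m)) (IH _ _ _ rm r'm) scalerA eqseq_cons eq_sym.
by case: (a == a'); rewrite ?mul1r ?mul0r.
Qed.

Lemma cc_contrV A m p k l x : ccalg A -> A x -> bidegree (m + k) (p + m + l) x ->
  A (contrV m p x) /\ bidegree k (p + l) (contrV m p x).
Proof.
move=> cA; elim: m x => [|m IH] x Ax xb /=; first by rewrite addn0 in xb.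
have H1 : (m < m.+1 + k)%N by rewrite addSn ltnS leq_addr.
have H2 : (p < p + m.+1 + l)%N by rewrite addnS addSn ltnS -addnA leq_addr.
apply: IH; first exact: cc_contr xb Ax.
by have := contr_bidegree H1 H2 xb; rewrite addSn addnS addSn.
Qed.

Lemma cc_contrW A m k l x : ccalg A -> A x -> bidegree (m + k) (m + l) x ->
  A (contrW m x) /\ bidegree k l (contrW m x).
Proof.
move=> cA; elim: m x => [|m IH] x Ax xb //=.
have H1 : (0 < m.+1 + k)%N by [].
have H2 : (m < m.+1 + l)%N by rewrite addSn ltnS leq_addr.
apply: IH; first exact: cc_contr xb Ax.
by have := contr_bidegree H1 H2 xb; rewrite addSn.
Qed.

(** The adjoint of the multiplication by b is built from star b, a product and
    contractions, that is, from operations under which A is closed. *)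
Lemma ip_adjoint p q k l b a y : bidegree p q b -> bidegree (p + k) (q + l) a ->
  ip (b * y) a = ip y (contrW p (contrV q p (star b * a))).
Proof.
move=> bb ab; rewrite [LHS]ipC [RHS]ipC; congr (_^*); move: a ab.
apply: (@bidegree_ext _ _ C^o).
- exact: ip_linl.
- by move=> c a a'; rewrite tmulDr (contrV_lin q p) (contrW_lin p) ipPl.
move=> s t sk tl; rewrite ipC [RHS]ipC; congr (_^*); move: b bb.
apply: (@bidegree_ext _ _ C^o).
- by move=> c b b'; rewrite tmulDl ipPl.
- move=> c b b'; rewrite starP tmulDl (contrV_lin q p) (contrW_lin p) ipPr conjCK //.
move=> u v up vq.
rewrite -(cat_take_drop p s) -(cat_take_drop q t).
set u1 := take p s; set u2 := drop p s; set v1 := take q t; set v2 := drop q t.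
have su1 : size u1 = p by rewrite size_takel // sk leq_addr.
have sv1 : size v1 = q by rewrite size_takel // tl leq_addr.
rewrite star_eb eb_mul contrV_eb ?size_rev // (linZ (@contrW_lin p)).
rewrite contrW_eb // scalerA -[X in ip y X]addr0 ipPr ip0r addr0.
rewrite -(eb_mul C u1) (@ip_mul _ _ p q); last 2 first.
- by rewrite -up -vq; exact: bidegree_eb.
- by rewrite -su1 -sv1; exact: bidegree_eb.
by rewrite ip_ebr coef_eb rmorphM /= !conjC_nat -natrM mulnb andbC.
Qed.

(** The orthogonal complement of A is a left module over A, because A is closed
    under the adjoints of the multiplications by its elements. *)
Lemma cc_perp_mul A p q k l b y a : ccalg A -> A b -> bidegree p q b ->
  (forall c, A c -> bidegree k l c -> ip y c = 0) ->
  A a -> bidegree (p + k) (q + l) a -> ip (b * y) a = 0.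
Proof.
move=> cA Ab bb yA Aa ab; rewrite (ip_adjoint y bb ab).
have Ax : A (star b * a) by apply: ccM => //; exact: cc_star.
have xb : bidegree (q + (p + k)) (p + q + l) (star b * a).
  by rewrite -addnA; apply: mul_bidegree => //; exact: star_bidegree.
have [A1 b1] := cc_contrV cA Ax xb.
by have [A2 b2] := cc_contrW cA A1 b1; exact: yA.
Qed.

Lemma tensIE : tensI = \sum_i eb C [:: i] [:: i] :> T.
Proof.
by apply: eq_bigr => i _; rewrite e_bw estar_bw tbasis_mul [eb]unlock.
Qed.

Lemma bidegree_sum (I : Type) (r : seq I) (P : pred I) k l (F : I -> T) :
  (forall i, P i -> bidegree k l (F i)) -> bidegree k l (\sum_(i <- r | P i) F i).
Proof.
move=> H; apply: (big_ind (bidegree k l)) => //; first exact: bidegree0.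
by move=> x y xb yb; rewrite -[x]scale1r; apply: bidegreeD.
Qed.

Lemma bidegree_tensI : bidegree 1 1 (tensI : T).
Proof. by rewrite tensIE; apply: bidegree_sum => i _; by have := @bidegree_eb C n [:: i] [:: i]. Qed.

(** Multiplying by I appends a pair of equal letters; contracting the appended
    V^*-letter with the i-th V-letter carries that letter to the end. *)
Definition move_to_end i l x : T := contr i l (x * tensI).

Lemma move_to_end_lin i l : @lin C n T (move_to_end i l).
Proof. by move=> a x y; rewrite /move_to_end tmulDl contrP. Qed.

Lemma move_to_end_eb i l a s t v : size s = i -> size v = l ->
  move_to_end i l (eb C (s ++ a :: t) v) = eb C (s ++ t ++ [:: a]) v.
Proof.
move=> si vl; rewrite /move_to_end tensIE mulr_sumr.
have D x y : contr i l (x + y) = contr i l x + contr i l y.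
  by rewrite -[x]scale1r contrP !scale1r.
rewrite (big_morph _ D (lin0 (@contr_lin C n i l))).
under eq_bigr => c _ do rewrite eb_mul -catA cat_cons contr_cat //.
rewrite (bigD1 a) //= eqxx scale1r cats0 big1 ?addr0 // => c /negPf ca.
by rewrite eq_sym ca scale0r.
Qed.

Lemma cc_move_to_end A k l i x : ccalg A -> A tensI -> (i < k)%N -> bidegree k l x -> A x -> A (move_to_end i l x).
Proof.
move=> cA AI ik xb Ax; have xI : bidegree (k + 1) (l + 1) (x * tensI).
  by apply: mul_bidegree => //; exact: bidegree_tensI.
apply: (cc_contr cA _ _ xI).
- by rewrite addn1 ltnS ltnW.
- by rewrite addn1.
- by apply: ccM.
Qed.

(** The tensor that reads the letters of a word w in the places listed by q on
    the V-side, against w itself on the V^*-side. *)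
Definition Jseq k (q : seq 'I_k) : T :=
  \sum_(w : k.-tuple 'I_n) eb C [seq tnth w i | i <- q] w.

Lemma Jseq_bidegree k (q : seq 'I_k) : bidegree (size q) k (Jseq q).
Proof.
apply: bidegree_sum => w _.
by have := @bidegree_eb C n [seq tnth w i | i <- q] w; rewrite size_map size_tuple.
Qed.

Lemma cc_Jseq_move A k (r1 r2 : seq 'I_k) c : ccalg A -> A tensI ->
  A (Jseq (r1 ++ c :: r2)) -> A (Jseq (r1 ++ r2 ++ [:: c])).
Proof.
move=> cA AI AJ; suff -> : Jseq (r1 ++ r2 ++ [:: c]) = move_to_end (size r1) k (Jseq (r1 ++ c :: r2)).
  apply: (cc_move_to_end cA AI _ (@Jseq_bidegree k _) AJ).
  by rewrite size_cat /= addnS ltnS leq_addr.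
have D x y : move_to_end (size r1) k (x + y) = move_to_end (size r1) k x + move_to_end (size r1) k y.
  by rewrite -[x]scale1r move_to_end_lin !scale1r.
rewrite /Jseq (big_morph _ D (lin0 (@move_to_end_lin (size r1) k))); apply: eq_bigr => w _.
by rewrite !map_cat /= move_to_end_eb ?size_map ?size_tuple.
Qed.

(** Letters can be taken out of r one by one in the order prescribed by s and
    moved to the end, so every reordering is reached. *)
Lemma cc_Jseq_perm A k (s r d : seq 'I_k) : ccalg A -> A tensI -> perm_eq s r ->
  A (Jseq (r ++ d)) -> A (Jseq (d ++ s)).
Proof.
move=> cA AI; elim: s r d => [|c s IH] r d sr.
  by move/perm_size: sr => /esym/size0nil ->; rewrite cats0.
have cr : c \in r by rewrite -(perm_mem sr) mem_head.
case/splitPr: cr sr => r1 r2 sr; rewrite -catA cat_cons => /(cc_Jseq_move cA AI).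
rewrite -catA catA => /IH; rewrite -catA /=; apply.
by rewrite -(perm_cons c); apply: (perm_trans sr); rewrite perm_catC /= perm_cons perm_catC.
Qed.

Lemma cc_Jseq_enum A k : ccalg A -> A tensI -> A (Jseq (enum 'I_k)).
Proof.
move=> cA AI.
have -> : Jseq (enum 'I_k) = \sum_(w : k.-tuple 'I_n) eb C w w.
  by apply: eq_bigr => w _; rewrite map_tnth_enum.
elim: k => [|k IH].
  rewrite (big_tuple0 (fun w => eb C w w)) -one_eb; exact: cc1.
suff -> : \sum_(w : k.+1.-tuple 'I_n) eb C w w = tensI * \sum_(w : k.-tuple 'I_n) eb C w w.
  exact: ccM.
rewrite (big_tupleS k (fun w => eb C w w)) tensIE big_distrlr /=.
by apply: eq_bigr => i _; apply: eq_bigr => w _; rewrite eb_mul.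
Qed.

(** The k-th power of I with its V-factors permuted by sg. *)
Definition Jperm k (sg : 'S_k) : T := Jseq [seq sg i | i <- enum 'I_k].

Lemma cc_Jperm A k (sg : 'S_k) : ccalg A -> A tensI -> A (Jperm sg).
Proof.
move=> cA AI; apply: (@cc_Jseq_perm A k _ (enum 'I_k) [::]) => //.
  apply: uniq_perm; rewrite ?(map_inj_uniq (@perm_inj _ sg)) ?enum_uniq //.
  move=> i; rewrite mem_enum; apply/mapP; exists (sg^-1 i)%g; rewrite ?mem_enum //.
  by rewrite permKV.
by rewrite cats0; exact: cc_Jseq_enum.
Qed.

Lemma Jperm_bidegree k (sg : 'S_k) : bidegree k k (Jperm sg).
Proof. by have := @Jseq_bidegree k [seq sg i | i <- enum 'I_k]; rewrite size_map size_enum_ord. Qed.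

End Closure.

(** * Operators commuting with all Kronecker powers *)

Section Commutant.
Variables (C : numClosedFieldType) (n k : nat).
Local Notation W := (k.-tuple 'I_n).
Implicit Types (M N U : 'M[C]_n) (u v w : W) (sg tau : 'S_k).

Definition polyfun (g : C -> C) := exists p : {poly C}, forall c, g c = p.[c].

Lemma polyfun_cst c : polyfun (fun _ => c).
Proof. by exists c%:P => x; rewrite hornerC. Qed.
Lemma polyfun_id : polyfun id.
Proof. by exists 'X => x; rewrite hornerX. Qed.
Lemma polyfunD g h : polyfun g -> polyfun h -> polyfun (fun c => g c + h c).
Proof. by move=> [p gp] [q hq]; exists (p + q) => c; rewrite hornerD gp hq. Qed.
Lemma polyfunM g h : polyfun g -> polyfun h -> polyfun (fun c => g c * h c).
Proof. by move=> [p gp] [q hq]; exists (p * q) => c; rewrite hornerM gp hq. Qed.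
Lemma polyfun_sum (I : Type) (r : seq I) (g : I -> C -> C) :
  (forall i, polyfun (g i)) -> polyfun (fun c => \sum_(i <- r) g i c).
Proof.
move=> H; elim: r => [|i r IH].
  by exists 0 => c; rewrite big_nil horner0.
have [p Hp] := polyfunD (H i) IH; exists p => c; by rewrite big_cons -Hp.
Qed.

Lemma polyfun_eq0 g : polyfun g -> (forall m : nat, g m%:R = 0) -> forall c, g c = 0.
Proof.
move=> [p gp] g0 c; rewrite gp; suff -> : p = 0 by rewrite horner0.
apply/eqP; apply/negPn/negP => p0.
pose rs := [seq (m%:R : C) | m <- iota 0 (size p)].
have : (size rs < size p)%N.
  apply: max_poly_roots => //.
    by apply/allP => _ /mapP[m _ ->]; rewrite /root -gp g0.
  by rewrite map_inj_uniq ?iota_uniq // => a b /eqP; rewrite eqr_nat => /eqP.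
by rewrite size_map size_iota ltnn.
Qed.

Lemma kron_polyfun X Y (s t : seq 'I_n) : polyfun (fun c => kron (X + c *: Y) s t).
Proof.
elim: s t => [|a s IH] [|b t] /=; try exact: polyfun_cst.
have : polyfun (fun c => (X a b + c * Y a b) * kron (X + c *: Y) s t).
  apply: polyfunM => //; apply: polyfunD; first exact: polyfun_cst.
  by apply: polyfunM; [exact: polyfun_id|exact: polyfun_cst].
by move=> [p Hp]; exists p => c; rewrite -Hp !mxE.
Qed.

Variable f : W -> W -> C.

(** f and X are matrices indexed by words of length k; this says that they
    commute. *)
Definition com (X : W -> W -> C) :=
  forall s r, \sum_(w : W) f s w * X w r = \sum_(w : W) X s w * f w r.
Definition com_kron M := com (fun u v => kron M u v).

Lemma com_kron_mul M N : com_kron M -> com_kron N -> com_kron (M *m N).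
Proof.
move=> cM cN s r.
under eq_bigr => w _ do rewrite (kron_mul M N r (size_tuple w)) mulr_sumr.
under [RHS]eq_bigr => w _ do rewrite (kron_mul M N w (size_tuple s)) mulr_suml.
rewrite exchange_big /=.
under eq_bigr => v _.
  under eq_bigr => w _ do rewrite mulrA.
  rewrite -mulr_suml cM mulr_suml.
  under eq_bigr => w _ do rewrite -mulrA.
  over.
rewrite exchange_big [RHS]exchange_big /=; apply: eq_bigr => v _.
rewrite -mulr_sumr cN mulr_sumr; apply: eq_bigr => w _; by rewrite mulrA.
Qed.

Lemma kron_diag (d : 'rV[C]_n) (s t : seq 'I_n) :
  kron (diag_mx d) s t = (s == t)%:R * \prod_(i <- s) d 0 i.
Proof.
elim: s t => [|a s IH] [|b t] /=; rewrite ?big_nil ?mul0r ?mulr1 //.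
rewrite IH big_cons mxE eqseq_cons; case: (a == b); last by rewrite mulr0n !mul0r.
by rewrite mulr1n mulrCA.
Qed.

(** A diagonal matrix acts on a word by a product that depends only on its
    letters with multiplicity. *)
Lemma com_kron_diag (d : 'rV[C]_n) : (forall s r, f s r != 0 -> perm_eq s r) ->
  com_kron (diag_mx d).
Proof.
move=> fP s r.
under eq_bigr => w _ do rewrite kron_diag.
under [RHS]eq_bigr => w _ do rewrite kron_diag.
rewrite (bigD1 r) //= eqxx mul1r [X in _ + X]big1 ?addr0 => [|w /negPf wr]; last first.
  by case: eqP => [/val_inj E|_]; [rewrite E eqxx in wr|rewrite mul0r mulr0].
rewrite (bigD1 s) //= eqxx mul1r [X in _ = _ + X]big1 ?addr0 => [|w /negPf ws]; last first.
  by case: eqP => [/val_inj E|_]; [rewrite E eqxx in ws|rewrite !mul0r].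
have [->|/fP sr] := eqVneq (f s r) 0; first by rewrite mul0r mulr0.
by rewrite mulrC (perm_big _ sr).
Qed.

(** From unitary to arbitrary matrices.  A normal matrix is unitarily
    diagonalizable, so its Kronecker power commutes with f.  If X and Y are
    Hermitian, all X + m Y with m a natural number are normal, and commutation is
    a polynomial identity in m; at m = 'i it covers every matrix. *)
Lemma com_kron_all : (forall s r, f s r != 0 -> perm_eq s r) ->
  (forall U, U \is unitarymx -> com_kron U) -> forall M, com_kron M.
Proof.
move=> fP fU.
have comN M : M \is normalmx -> com_kron M.
  move=> /orthomx_spectralP ->.
  have PU := spectral_unitarymx M.
  apply: com_kron_mul; last exact: fU.
  by apply: com_kron_mul; [apply/fU/unitary_inv|exact: com_kron_diag].
have comXY (X Y : 'M[C]_n) c : (forall m : nat, X + m%:R *: Y \is normalmx) -> com_kron (X + c *: Y).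
  move=> XY s r; apply/eqP; rewrite -subr_eq0; apply/eqP.
  pose g c := \sum_(w : W) f s w * kron (X + c *: Y) w r - \sum_(w : W) kron (X + c *: Y) s w * f w r.
  apply: (@polyfun_eq0 g) => [|m]; last by rewrite /g comN ?subrr.
  have -> : g = (fun c => \sum_(w : W) f s w * kron (X + c *: Y) w r + (-1) * \sum_(w : W) kron (X + c *: Y) s w * f w r).
    by apply/funext => c'; rewrite mulN1r.
  apply: polyfunD; last (apply: polyfunM; first exact: polyfun_cst).
    apply: polyfun_sum => w; apply: polyfunM; [exact: polyfun_cst|exact: kron_polyfun].
  apply: polyfun_sum => w; apply: polyfunM; [exact: kron_polyfun|exact: polyfun_cst].
move=> M.
(* M = X + 'i Y with X and Y Hermitian. *)
pose X := 2^-1 *: (M + (M ^t*)%sesqui); pose Y := (2^-1 * - 'i) *: (M - (M ^t*)%sesqui).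
have tK (N : 'M[C]_n) : ((N ^t*)%sesqui ^t*)%sesqui = N.
  by rewrite map_trmx trmxK -map_mx_comp map_mx_id // => a /=; rewrite conjCK.
have tD (N N' : 'M[C]_n) : ((N + N') ^t*)%sesqui = (N ^t*)%sesqui + (N' ^t*)%sesqui.
  by rewrite linearD map_mxD.
have tZ a (N : 'M[C]_n) : ((a *: N) ^t*)%sesqui = a^* *: (N ^t*)%sesqui.
  by apply/matrixP => i j; rewrite !mxE rmorphM.
have half : (2^-1 : C)^* = 2^-1 by apply: conj_Creal; rewrite realV realn.
have hX : (X ^t*)%sesqui = X.
  by rewrite /X tZ tD tK addrC half.
have hY : (Y ^t*)%sesqui = Y.
  rewrite /Y tZ -scaleN1r tD tZ tK rmorphM rmorphN /= half conjCi opprK rmorphN1.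
  by rewrite !scaleN1r mulrN scaleNr -scalerN opprB.
have ME : M = X + 'i *: Y.
  rewrite /X /Y scalerA mulrCA mulrN -expr2 sqrCi opprK mulr1 -scalerDr addrACA subrr addr0.
  by rewrite -mulr2n -scaler_nat scalerA mulVf ?scale1r // pnatr_eq0.
rewrite {}ME; clearbody X Y; apply: comXY => m; apply/normalmxP.
by rewrite tD tZ hX hY conjC_nat.
Qed.

Lemma kron_prod M u v : kron M u v = \prod_(j < k) M (tnth u j) (tnth v j).
Proof.
elim: k u v => [|m IH] u v; first by rewrite (tuple0 u) (tuple0 v) big_ord0.
rewrite big_ord_recl; case/tupleP: u => a u; case/tupleP: v => b v /=.
rewrite IH; congr (_ * _); apply: eq_bigr => j _.
by rewrite !tnthS.
Qed.

(** Inclusion-exclusion, obtained by expanding a product of sums that are zero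
    at the points outside B. *)
Lemma sum_sign_superset (B : {set 'I_k}) :
  \sum_(S : {set 'I_k}) (-1) ^+ #|S| * (B \subset S)%:R = (#|B| == k)%:R * (-1) ^+ k :> C.
Proof.
have -> : (#|B| == k)%:R * (-1) ^+ k = \prod_(i < k) (-1 + (i \notin B)%:R) :> C.
  have [/eqP Bk|BT] := boolP (#|B| == k).
    rewrite mul1r (eq_bigr (fun _ => -1)) ?prodr_const ?card_ord // => i _.
    suff -> : i \in B by rewrite addr0.
    have E : #|B| = #|'I_k| by rewrite Bk card_ord.
    by rewrite (elimT (subset_cardP E) (subset_predT _)).
  have [i iB] : exists i, i \notin B.
    apply/existsP; rewrite -negb_forall; apply: contra BT => /forallP H.
    by rewrite -[k in X in _ == X]card_ord; apply/eqP/eq_card => i; rewrite H.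
  by rewrite (bigD1 i) //= iB addrC subrr !mul0r.
rewrite bigA_distr; apply: eq_bigr => S _.
rewrite (bigID (mem S)) /= -[#|S|]card_ord.
rewrite (eq_bigr (fun _ => -1)) => [|i ->//]; rewrite prodr_const; congr (_ ^+ _ * _).
  by rewrite card_ord.
rewrite (eq_bigr (fun i => (i \notin B)%:R)) => [|i /negPf ->//].
apply/esym; case: (boolP (B \subset S)) => [/fintype.subsetP BS|/fintype.subsetPn[i iB iS]].
  by rewrite big1 // => i iS; rewrite (contra (BS i) iS).
by rewrite (bigD1 i) //= iB mul0r.
Qed.

(** Expanding the Kronecker power of a sum gives all maps g from places to
    summands; the alternating sum over S keeps the surjective ones, which are the
    permutations. *)
Lemma polarization (M : 'I_k -> 'M[C]_n) u v :
  \sum_(S : {set 'I_k}) (-1) ^+ #|S| * kron (\sum_(i in S) M i) u v =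
  (-1) ^+ k * \sum_(sg : 'S_k) \prod_(j < k) M (sg j) (tnth u j) (tnth v j).
Proof.
have E (S : {set 'I_k}) : kron (\sum_(i in S) M i) u v =
  \sum_(g : {ffun 'I_k -> 'I_k}) ((g @: 'I_k) \subset S)%:R *
     \prod_(j < k) M (g j) (tnth u j) (tnth v j).
  rewrite kron_prod.
  under eq_bigr => j _ do rewrite summxE big_mkcond /=.
  rewrite bigA_distr_bigA /=; apply: eq_bigr => g _.
  case: (boolP (_ \subset S)) => [/fintype.subsetP gS|/fintype.subsetPn[i /imsetP[j _ ->] iS]].
    rewrite mul1r; apply: eq_bigr => j _; by rewrite gS ?imset_f.
  by rewrite mul0r (bigD1 j) //= (negPf iS) mul0r.
under eq_bigr => S _ do rewrite E mulr_sumr.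
rewrite exchange_big /=.
under eq_bigr => g _.
  under eq_bigr => S _ do rewrite mulrA.
  rewrite -mulr_suml sum_sign_superset.
  over.
rewrite (bigID (fun g : {ffun 'I_k -> 'I_k} => injectiveb g)) /= [X in _ + X]big1 ?addr0; last first.
  move=> g gN; case: eqP => [gT|]; last by rewrite !mul0r.
  have /imset_injP ginj : #|g @: 'I_k| == #|'I_k| by rewrite gT card_ord.
  by case/negP: gN; apply/injectiveP => i j; exact: ginj.
rewrite (reindex (@pval _)) /=; last first.
  pose in_perm := insubd (1%g : 'S_k).
  by exists in_perm => /= f' If; [apply: val_inj; rewrite insubdK|rewrite insubdK].
rewrite mulr_sumr; apply: eq_big => [sg|sg _]; first by rewrite (valP sg).
have -> : #|(pval sg) @: 'I_k| == k.
  by rewrite card_imset ?card_ord // => i j; rewrite !pvalE; exact: perm_inj.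
rewrite mul1r; congr (_ * _); apply: eq_bigr => j _; by rewrite pvalE.
Qed.

Definition perm_word sg u : W := [tuple tnth u (sg i) | i < k].

Lemma perm_wordM sg tau u : perm_word sg (perm_word tau u) = perm_word (sg * tau)%g u.
Proof. by apply: eq_from_tnth => i; rewrite !tnth_mktuple permM. Qed.
Lemma perm_word1 u : perm_word 1%g u = u.
Proof. by apply: eq_from_tnth => i; rewrite !tnth_mktuple perm1. Qed.
Lemma perm_wordK sg : cancel (perm_word sg) (perm_word sg^-1%g).
Proof. by move=> u; rewrite perm_wordM mulVg perm_word1. Qed.
Lemma perm_wordVK sg : cancel (perm_word sg^-1%g) (perm_word sg).
Proof. by move=> u; rewrite perm_wordM mulgV perm_word1. Qed.

Lemma com_sum (I : Type) (r : seq I) (X : I -> W -> W -> C) :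
  (forall i, com (X i)) -> com (fun u v => \sum_(i <- r) X i u v).
Proof.
move=> cX s t; under eq_bigr => w _ do rewrite mulr_sumr.
under [RHS]eq_bigr => w _ do rewrite mulr_suml.
by rewrite exchange_big [RHS]exchange_big /=; apply: eq_bigr => i _; exact: cX.
Qed.

Lemma com_scale c X : com X -> com (fun u v => c * X u v).
Proof.
move=> cX s t; under eq_bigr => w _ do rewrite mulrCA.
by rewrite -mulr_sumr cX mulr_sumr; apply: eq_bigr => w _; rewrite mulrA.
Qed.

Lemma com_ext X Y : (forall u v, X u v = Y u v) -> com X -> com Y.
Proof.
move=> XY cX s t; have := cX s t.
under eq_bigr => w _ do rewrite XY.
by under [X in _ = X -> _]eq_bigr => w _ do rewrite XY.
Qed.

(** Operators invariant under simultaneous permutation of rows and columns are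
    combinations of symmetrized elementary matrices, and those are polarizations
    of Kronecker powers. *)
Lemma com_sym (cM : forall M, com_kron M) X :
  (forall sg u v, X (perm_word sg u) (perm_word sg v) = X u v) -> com X.
Proof.
move=> Xsym.
pose E a b u v : C := \sum_(sg : 'S_k) \prod_(j < k) (delta_mx (tnth a (sg j)) (tnth b (sg j)) : 'M[C]_n) (tnth u j) (tnth v j).
have cE a b : com (E a b).
  apply: (@com_ext (fun u v => (-1) ^+ k *
    \sum_(S : {set 'I_k}) (-1) ^+ #|S| * kron (\sum_(i in S) delta_mx (tnth a i) (tnth b i)) u v)).
    by move=> u v; rewrite polarization mulrA -exprMn mulrNN mulr1 expr1n mul1r.
  by apply: com_scale; apply: com_sum => S; apply: com_scale; exact: cM.
have EE a b u v : E a b u v = \sum_(sg : 'S_k) ((u == perm_word sg a) && (v == perm_word sg b))%:R.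
  apply: eq_bigr => sg _; case: andP => [[/eqP -> /eqP ->]|uv].
    by rewrite big1 // => j _; rewrite !tnth_mktuple mxE !eqxx.
  have [j /negPf jN] : exists j, ~~ ((tnth u j == tnth a (sg j)) && (tnth v j == tnth b (sg j))).
    apply/existsP; rewrite -negb_forall; apply/negP => /forallP H; case: uv.
    by split; apply/eqP/eq_from_tnth => j; rewrite tnth_mktuple; case/andP: (H j) => /eqP ? /eqP ?.
  by rewrite (bigD1 j) //= mxE jN mul0r.
apply: (@com_ext (fun u v => (#|'S_k|%:R)^-1 * \sum_(p : W * W) X p.1 p.2 * E p.1 p.2 u v)).
  move=> u v; have k0 : (#|'S_k|%:R : C) != 0 by rewrite pnatr_eq0 -lt0n; apply/card_gt0P; exists 1%g.
  apply: (mulfI k0); rewrite mulVKf //.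
  under eq_bigr => p _ do rewrite EE mulr_sumr.
  rewrite exchange_big /= (eq_bigr (fun _ => X u v)) ?sumr_const ?mulr_natl // => sg _.
  rewrite (bigD1 (perm_word sg^-1%g u, perm_word sg^-1%g v)) //= !perm_wordVK !eqxx mulr1 Xsym.
  rewrite big1 ?addr0 // => -[a b] /= ab; case: andP => [[/eqP uE /eqP vE]|]; last by rewrite mulr0.
  by case/eqP: ab; rewrite uE vE !perm_wordK.
by apply: com_scale; apply: com_sum => p; apply: com_scale; exact: cE.
Qed.

(** The half of Schur-Weyl duality that is needed: f commutes with Kronecker
    powers, y is orthogonal to the permutation operators, and then f and y are
    orthogonal.  The operator q = sum over sg of <., P_sg y> P_sg y kills the
    identity, and in its first index it commutes with permutations; hence f passes
    through it and q f = 0, while <q f, f> is the sum of all |<f, P_sg y>|^2. *)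
Lemma commutant_orthogonal (cM : forall M, com_kron M) (y : W -> W -> C) :
  (forall sg, \sum_(w : W) y (perm_word sg w) w = 0) -> \sum_(u : W) \sum_(w : W) f u w * (y u w)^* = 0.
Proof.
move=> yJ.
(* The blocks of the operator q, at column indices w and w'. *)
pose X w w' u v := \sum_(sg : 'S_k) y (perm_word sg u) w * (y (perm_word sg v) w')^*.
have cX w w' : com (X w w').
  apply: com_sym => // tau u v; rewrite /X.
  rewrite (reindex_inj (mulIg tau^-1)%g) /=; apply: eq_bigr => sg _.
  by rewrite !perm_wordM mulgKV.
pose q u w := \sum_(w' : W) \sum_(v : W) X w w' u v * f v w'.
have q0 u w : q u w = 0.
  rewrite /q; under eq_bigr => w' _ do rewrite -cX.
  rewrite exchange_big /=; apply: big1 => v _; rewrite -mulr_sumr /X exchange_big /=.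
  rewrite big1 ?mulr0 // => sg _; rewrite -mulr_sumr.
  by rewrite -rmorph_sum /= yJ rmorph0 mulr0.
have : \sum_(u : W) \sum_(w : W) (f u w)^* * q u w = 0.
  by rewrite big1 // => u _; rewrite big1 // => w _; rewrite q0 mulr0.
pose F sg := \sum_(v : W) \sum_(w : W) f v w * (y (perm_word sg v) w)^*.
have -> : \sum_(u : W) \sum_(w : W) (f u w)^* * q u w = \sum_(sg : 'S_k) `|F sg| ^+ 2.
  under [RHS]eq_bigr => sg _ do rewrite normCKC.
  have FE sg : (F sg)^* = \sum_(u : W) \sum_(w : W) (f u w)^* * y (perm_word sg u) w.
    rewrite rmorph_sum; apply: eq_bigr => u _; rewrite rmorph_sum; apply: eq_bigr => w _.
    by rewrite rmorphM /= conjCK.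
  under [RHS]eq_bigr => sg _ do rewrite FE mulr_suml.
  rewrite [RHS]exchange_big /=; apply: eq_bigr => u _.
  under [RHS]eq_bigr => sg _ do rewrite mulr_suml.
  rewrite [RHS]exchange_big /=; apply: eq_bigr => w _.
  under [RHS]eq_bigr => sg _ do rewrite -mulrA.
  rewrite -mulr_sumr; congr (_ * _); rewrite /q exchange_big /=.
  under [RHS]eq_bigr => sg _ do rewrite /F mulr_sumr.
  rewrite [RHS]exchange_big /=; apply: eq_bigr => v _.
  under [RHS]eq_bigr => sg _ do rewrite mulr_sumr.
  rewrite [RHS]exchange_big /=; apply: eq_bigr => w' _.
  by rewrite /X mulr_suml; apply: eq_bigr => sg _; rewrite [f v w' * _]mulrC mulrA.
move/eqP; rewrite psumr_eq0 => [/allP/(_ 1%g)|sg _]; last by rewrite exprn_ge0.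
rewrite mem_index_enum sqrf_eq0 normr_eq0 => /(_ isT)/eqP F1; rewrite -[RHS]F1 /F.

by under [RHS]eq_bigr => u _ do rewrite perm_word1.
Qed.

End Commutant.

(** * Invariants of the unitary group *)

Section FFT.
Variables (C : numClosedFieldType) (n : nat).
Local Notation T := (mtensor C n).
Implicit Types (U W : 'M[C]_n) (x y z : T) (s t : seq 'I_n).

(** The Cayley transform of m: infinitely many points of the unit circle. *)
Definition unitpt (m : nat) : C := (m%:R + 'i) / (m%:R - 'i).

Lemma unitpt_den (m : nat) : (m%:R - 'i : C) != 0.
Proof.
rewrite subr_eq0; apply/eqP => E; have := congr1 (fun c : C => c ^+ 2) E.
rewrite sqrCi => H; have : (0 : C) <= -1 by rewrite -H exprn_ge0 // ler0n.
by rewrite ler0N1.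
Qed.

Lemma unitpt_conj m : unitpt m * (unitpt m)^* = 1.
Proof.
have D := unitpt_den m; have D' : (m%:R + 'i : C) != 0.
  apply: contraNneq D => E; apply/eqP; rewrite -[LHS]conjCK rmorphB /= conjCi conjC_nat opprK.
  by rewrite E conjC0.
rewrite /unitpt rmorphM fmorphV rmorphB rmorphD /= conjCi conjC_nat opprK.
by rewrite mulrA divfK // divff.
Qed.

Lemma unitpt_inj : injective unitpt.
Proof.
have E m : unitpt m = 1 + 2 * 'i / (m%:R - 'i).
  rewrite -{1}(divff (unitpt_den m)) -mulrDl; congr (_ / _).
  by rewrite mulr_natl mulr2n addrA subrK.
move=> a b; rewrite !E => /addrI /mulfI H.
have /H/invr_inj/addIr/eqP : 2 * 'i != 0 :> C by rewrite mulf_neq0 ?neq0Ci ?pnatr_eq0.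
by rewrite eqr_nat => /eqP.
Qed.

Lemma unit_exp_inj a b : (forall c : C, c * c^* = 1 -> c ^+ a = c ^+ b) -> a = b.
Proof.
move=> H; apply/eqP; apply/negPn/negP => ab.
pose p : {poly C} := 'X^a - 'X^b.
have p0 : p != 0.
  rewrite subr_eq0; apply: contra ab => /eqP E.
  by have := congr1 (fun q : {poly C} => size q) E; rewrite !size_polyXn => -[->].
have : (size [seq unitpt m | m <- iota 0 (size p)] < size p)%N.
  apply: max_poly_roots => //; last by rewrite map_inj_uniq ?iota_uniq //; exact: unitpt_inj.
  apply/allP => _ /mapP[m _ ->]; rewrite /root hornerD hornerN !hornerXn subr_eq0; apply/eqP.
  exact/H/unitpt_conj.
by rewrite size_map size_iota ltnn.
Qed.

Definition word_invariant (k l : nat) (f : seq 'I_n -> seq 'I_n -> C) :=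
  forall U, U \is unitarymx -> forall s t, size s = k -> size t = l ->
  f s t = \sum_(u : k.-tuple 'I_n) \sum_(v : l.-tuple 'I_n)
    kron U s u * kron (map_mx Num.conj U) t v * f u v.

(** The unitary matrix with entry c in the diagonal place i and 1 elsewhere
    scales a word by a power of c that counts the letter i. *)
Lemma invariant_letters k l f s t : word_invariant k l f -> size s = k -> size t = l -> f s t != 0 -> perm_eq s t.
Proof.
move=> finv sk tl f0; apply/allP => i _ /=; apply/eqP/unit_exp_inj => c c1.
pose d : 'rV[C]_n := \row_j (if j == i then c else 1).
have dU : diag_mx d \is unitarymx.
  apply/unitarymxP; rewrite tr_diag_mx map_diag_mx mulmx_diag -diag_const_mx; congr diag_mx.
  apply/rowP => j; rewrite !mxE; case: eqP => // _; by rewrite rmorph1 mulr1.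
have dE r : \prod_(j <- r) d 0 j = c ^+ count_mem i r.
  elim: r => [|j r IH]; first by rewrite big_nil.
  by rewrite big_cons IH mxE /=; case: eqP => _; rewrite ?add1n ?exprS ?add0n ?mul1r.
have := finv _ dU s t sk tl.
have -> : \sum_(u : k.-tuple 'I_n) \sum_(v : l.-tuple 'I_n)
    kron (diag_mx d) s u * kron (map_mx Num.conj (diag_mx d)) t v * f u v =
  \sum_(u : k.-tuple 'I_n) (\sum_(v : l.-tuple 'I_n)
    c ^+ count_mem i s * (c ^+ count_mem i t)^* * f u v * (t == v)%:R) * (s == u)%:R.
  apply: eq_bigr => u _; rewrite mulr_suml; apply: eq_bigr => v _.
  rewrite kron_conj !kron_diag !dE rmorphM /= conjC_nat; ring.
rewrite (big_tuple_pick k s (fun u => \sum_(v : l.-tuple 'I_n)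
    c ^+ count_mem i s * (c ^+ count_mem i t)^* * f u v * (t == v)%:R)) sk eqxx.
rewrite (big_tuple_pick l t (fun v => c ^+ count_mem i s * (c ^+ count_mem i t)^* * f s v)) tl eqxx.
rewrite -[LHS]mul1r => /(mulIf f0) /esym E.
have E2 : (c ^+ count_mem i t)^* * c ^+ count_mem i t = 1.
  by rewrite mulrC rmorphXn -exprMn c1 expr1n.
by rewrite -[LHS]mulr1 -E2 mulrA E mul1r.
Qed.

(** The first fundamental theorem for the unitary group, in dual form: what is
    orthogonal to the permuted powers of I is orthogonal to the invariants.  In
    bidegrees with k != l the letter count leaves no invariants at all. *)
Lemma fft_orth k l f (y : T) : word_invariant k l f -> (forall sg : 'S_k, k = l -> ip y (Jperm C n sg) = 0) ->
  \sum_(u : k.-tuple 'I_n) \sum_(v : l.-tuple 'I_n) f u v * (y@_(bw u v))^* = 0.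
Proof.
move=> finv yJ; have [kl|kl] := eqVneq k l; last first.
  rewrite big1 // => u _; rewrite big1 // => v _.
  have [->|/invariant_letters H] := eqVneq (f u v) 0; first by rewrite mul0r.
  by have := perm_size (H _ _ finv (size_tuple u) (size_tuple v)); rewrite !size_tuple => E; rewrite E eqxx in kl.
subst l.
apply: (@commutant_orthogonal C n k (fun u v => f u v) _ (fun u v => y@_(bw u v))).
  apply: com_kron_all => [s r|U Uu s r].
    exact: (invariant_letters finv (size_tuple s) (size_tuple r)).
  under eq_bigr => w _ do rewrite (finv U Uu s w (size_tuple s) (size_tuple w)) mulr_suml.
  rewrite exchange_big /=; apply: eq_bigr => u _.
  under eq_bigr => w _ do rewrite mulr_suml.
  rewrite exchange_big /=.
  transitivity (\sum_(v : k.-tuple 'I_n) kron U s u * f u v * (val v == r)%:R).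
    apply: eq_bigr => v _.
    have UtU : (map_mx Num.conj U)^T *m U = 1%:M.
      by rewrite map_trmx -invmx_unitary // mulVmx // unitary_unit.
    rewrite -kron1 -UtU (kron_mul _ _ _ (size_tuple v)) mulr_sumr; apply: eq_bigr => w _.
    rewrite kron_tr; ring.
  under eq_bigr => v _ do rewrite eq_sym.
  by rewrite (big_tuple_pick k r (fun v => kron U s u * f u v)) size_tuple eqxx.
move=> sg; have := yJ sg (erefl k); rewrite /Jperm /Jseq.
have ip_sumr (I : Type) (r : seq I) (F : I -> T) : ip y (\sum_(i <- r) F i) = \sum_(i <- r) ip y (F i).
  elim: r => [|i r IH]; first by rewrite !big_nil ip0r.
  by rewrite !big_cons -[F i]scale1r ipPr conjC1 mul1r scale1r IH.
rewrite ip_sumr => H; rewrite -[RHS]H; apply: eq_bigr => w _; rewrite ip_ebr; congr (_@_(bw _ _)).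
by rewrite -map_comp.
Qed.

End FFT.

(** * Limits along ultrafilters and compactness of the unitary group *)

Section Limits.
Variables (K : numFieldType) (X : Type) (F : set_system X).
Hypothesis FF : ProperFilter F.
Implicit Types (f g : X -> K) (a b l : K).

(** Convergence along F, for values in a field with no topology attached. *)
Definition cvgF f l := forall e, 0 < e -> F [set x | `|f x - l| < e].

Lemma cvgF_near f g l : F [set x | f x = g x] -> cvgF f l -> cvgF g l.
Proof.
move=> fg fl e e0; apply: filterS (filterI fg (fl e e0)) => x [/= -> //].
Qed.

Lemma cvgF_cst a : cvgF (fun _ => a) a.
Proof. by move=> e e0; apply: filterS filterT => x _ /=; rewrite subrr normr0. Qed.

Lemma cvgFD f g l m : cvgF f l -> cvgF g m -> cvgF (fun x => f x + g x) (l + m).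
Proof.
move=> fl gm e e0; have e2 : 0 < e / 2 by rewrite divr_gt0 // ltr0n.
apply: filterS (filterI (fl _ e2) (gm _ e2)) => x [/= H1 H2].
rewrite opprD addrACA (le_lt_trans (ler_normD _ _)) // [e]splitr; exact: ltrD.
Qed.

Lemma cvgFZ a f l : cvgF f l -> cvgF (fun x => a * f x) (a * l).
Proof.
move=> fl e e0; have d0 : 0 < e / (`|a| + 1) by rewrite divr_gt0 // ltr_wpDl.
apply: filterS (fl _ d0) => x /= H; rewrite -mulrBr normrM.
apply: (@le_lt_trans _ _ ((`|a| + 1) * `|f x - l|)).
  by rewrite ler_wpM2r // lerDl.
by rewrite mulrC -ltr_pdivlMr // ltr_wpDl.
Qed.

Lemma cvgFM f g l m : cvgF f l -> cvgF g m -> cvgF (fun x => f x * g x) (l * m).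
Proof.
move=> fl gm.
(* f g - l m = (f - l) (g - m) + l (g - m) + m (f - l); for the first term
   keep one factor below 1. *)
have H : cvgF (fun x => (f x - l) * (g x - m)) 0.
  move=> e e0; have d0 : 0 < e / (e + 1) by rewrite divr_gt0 // addr_gt0.
  have d1 : e / (e + 1) < 1 by rewrite ltr_pdivrMr ?addr_gt0 // mul1r ltrDl.
  apply: filterS (filterI (fl _ d0) (gm 1 ltr01)) => x [/= H1 H2].
  rewrite subr0 normrM; apply: (@le_lt_trans _ _ `|f x - l|); first by rewrite ler_piMr // ltW.
  by apply: lt_le_trans H1 _; rewrite ler_pdivrMr ?addr_gt0 // ler_peMr ?lerDr // ltW.
have G := cvgFD (cvgFD H (cvgFZ l gm)) (cvgFD (cvgFZ m fl) (cvgF_cst (- (l * m)))).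
have -> : l * m = 0 + l * m + (m * l - l * m) by ring.
apply: cvgF_near G; apply: filterS filterT => x _ /=; ring.
Qed.

Lemma cvgF_sum (I : Type) (r : seq I) (f : I -> X -> K) (l : I -> K) :
  (forall i, cvgF (f i) (l i)) -> cvgF (fun x => \sum_(i <- r) f i x) (\sum_(i <- r) l i).
Proof.
move=> H; elim: r => [|i r IH].
  rewrite big_nil; apply: cvgF_near (cvgF_cst 0); apply: filterS filterT => x _ /=.
  by rewrite big_nil.
rewrite big_cons; apply: cvgF_near (cvgFD (H i) IH); apply: filterS filterT => x _ /=.
by rewrite big_cons.
Qed.

Lemma cvgF_unique f l m : cvgF f l -> cvgF f m -> l = m.
Proof.
move=> fl fm; apply/eqP; rewrite -subr_eq0 -normr_eq0; apply/negPn/negP => N0.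
have d0 : 0 < `|l - m| / 2 by rewrite divr_gt0 ?ltr0n // lt_def N0 normr_ge0.
have [x [/= H1 H2]] := filter_ex (filterI (fl _ d0) (fm _ d0)).
have : `|l - m| < `|l - m|.
  rewrite {1}(_ : l - m = (f x - m) - (f x - l)); last by ring.
  apply: le_lt_trans (ler_normB _ _) _; rewrite [X in _ < X]splitr; exact: ltrD.
by rewrite ltxx.
Qed.

Lemma cvgF_norm f l : cvgF f l -> cvgF (fun x => `|f x|) `|l|.
Proof.
move=> fl e e0; apply: filterS (fl e e0) => x /= H.
by apply: le_lt_trans H; exact: ler_dist_dist.
Qed.

Lemma cvgF_ge0 f l : F [set x | 0 <= f x] -> cvgF f l -> 0 <= l.
Proof.
move=> f0 fl; rewrite (cvgF_unique fl (_ : cvgF f `|l|)) //.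
apply: cvgF_near (cvgF_norm fl); apply: filterS f0 => x /= f0; exact: ger0_norm.
Qed.

End Limits.

Lemma cvgF_conj (C : numClosedFieldType) (X : Type) (F : set_system X)
  (FF : ProperFilter F) (f : X -> C) (l : C) :
  cvgF F f l -> cvgF F (fun x => (f x)^*) l^*.
Proof.
by move=> fl e e0; apply: filterS (fl e e0) => x /=; rewrite -rmorphB norm_conjC.
Qed.

Section Ultra.
Variables (R : realType) (X : Type) (F : set_system X).
Hypothesis FU : UltraFilter F.

(** The limit is the supremum of the a such that f >= a on a set of F. *)
Lemma ultra_real (f : X -> R) (B : R) : F [set x | `|f x| <= B] -> exists l, cvgF F f l.
Proof.
move=> fB; have FF := @ultra_proper _ _ FU.
pose A := [set a : R | F [set x | a <= f x]].
have ubA a : A a -> a <= B.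
  move=> Aa; have [x [/= H1 H2]] := filter_ex (filterI Aa fB).
  by apply: le_trans H1 (le_trans (ler_norm _) H2).
have A0 : A (- B).
  by apply: filterS fB => x /=; rewrite ler_norml => /andP[].
have sA : has_sup A by split; [exists (- B)|exists B => a; exact: ubA].
exists (sup A) => e e0.
have [a Aa ea] := sup_adherent e0 sA.
have NA : ~ A (sup A + e / 2).
  by move=> /(sup_upper_bound sA); lra.
have [//|G] := in_ultra_setVsetC [set x | sup A + e / 2 <= f x] FU.
apply: filterS (filterI Aa G) => x [/= H1 /negP]; rewrite -ltNge => H2.
rewrite ltr_norml; apply/andP; split; lra.
Qed.

Lemma norm_realC (x : R) : `|x%:C%C| = `|x|%:C%C :> R[i].
Proof. by rewrite normc_def /= expr0n addr0 sqrtr_sqr. Qed.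

Lemma cvgF_realC (f : X -> R) l : cvgF F f l -> cvgF F (fun x => (f x)%:C%C : R[i]) l%:C%C.
Proof.
have FF := @ultra_proper _ _ FU.
move=> fl e; rewrite ltcE /= => /andP[/eqP e1 e0].
apply: filterS (fl _ e0) => x /= H.
by rewrite -rmorphB norm_realC ltcE /= e1 eqxx.
Qed.

Lemma ultra_complex (f : X -> R[i]) (B : R[i]) : F [set x | `|f x| <= B] -> exists l, cvgF F f l.
Proof.
move=> fB; have FF := @ultra_proper _ _ FU.
have [b bB] : exists b : R, F [set x | complex.Re (f x) ^+ 2 + complex.Im (f x) ^+ 2 <= b ^+ 2 /\ 0 <= b].
  exists (complex.Re B); apply: filterS fB => x /= H.
  have B0 : 0 <= B by apply: le_trans H.
  have Bb : (complex.Re B)%:C%C = B by apply: RRe_real; exact: ger0_real.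
  split; last by move: B0; rewrite lecE => /andP[].
  by rewrite -lecR rmorphXn /= Bb add_Re2_Im2 lerXn2r ?nnegrE.
have le_sq (x b' : R) : x ^+ 2 <= b' ^+ 2 -> 0 <= b' -> `|x| <= b'.
  by move=> H b0; rewrite -(ler_pXn2r (ltn0Sn 1)) ?nnegrE // -normrX ger0_norm ?sqr_ge0.
have [l1 H1] : exists l, cvgF F (fun x => complex.Re (f x)) l.
  apply: (@ultra_real _ b); apply: filterS bB => x /= [H b0].
  by apply: le_sq b0; apply: le_trans H; rewrite lerDl sqr_ge0.
have [l2 H2] : exists l, cvgF F (fun x => complex.Im (f x)) l.
  apply: (@ultra_real _ b); apply: filterS bB => x /= [H b0].
  by apply: le_sq b0; apply: le_trans H; rewrite lerDr sqr_ge0.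
exists (l1%:C%C + 'i%C * l2%:C%C).
apply: cvgF_near (cvgFD FF (cvgF_realC H1) (cvgFZ FF 'i%C (cvgF_realC H2))).
by apply: filterS filterT => x _ /=; rewrite -complexE.
Qed.

End Ultra.

(** The three facts about the complex numbers on which the argument depends,
    this one, near_minima and no_gap below, are stated for a field of scalars, so
    that the rest is carried out over an arbitrary numClosedFieldType. *)
Definition bounded_limits (K : numFieldType) := forall (X : Type) (F : set_system X)
  (f : X -> K) (B : K), UltraFilter F -> F [set x | `|f x| <= B] -> exists l, cvgF F f l.

Definition near_minima (K : numFieldType) := forall (X : Type) (P : set X) (q : X -> K) (e : K),
  P !=set0 -> (forall x, 0 <= q x) -> 0 < e ->
  exists2 x, P x & forall y, P y -> q x <= q y + e.

Lemma bounded_limits_complex (R : realType) : bounded_limits R[i].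
Proof. by move=> X F f B FU; exact: ultra_complex. Qed.

Lemma near_minima_complex (R : realType) : near_minima R[i].
Proof.
move=> X P q e [x0 Px0] q0; rewrite ltcE /= => /andP[/eqP e1 e0].
pose S := [set complex.Re (q x) | x in P].
have qE x : q x = (complex.Re (q x))%:C%C by apply/esym/RRe_real/ger0_real.
have Rq0 x : 0 <= complex.Re (q x) by have := q0 x; rewrite lecE => /andP[].
have hS : has_inf S.
  by split; [exists (complex.Re (q x0)), x0|exists 0 => _ [x _ <-]].
have [_ [x Px <-] xe] := inf_adherent e0 hS.
have eE : e = (complex.Re e)%:C%C by case: (e) e1 => a b /= ->.
exists x => // y Py; rewrite (qE x) (qE y) eE -rmorphD lecR.
have : inf S <= complex.Re (q y) by apply: ge_inf => //; [case: hS|exists y].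
by move=> ?; lra.
Qed.

Section UnitaryCompact.
Variables (C : numClosedFieldType) (n : nat).
Hypothesis Clim : bounded_limits C.
Local Notation T := (mtensor C n).

Lemma unitary_entry (U : 'M[C]_n) i j : U \is unitarymx -> `|U i j| <= 1.
Proof.
move=> /unitarymxP UU; have := congr1 (fun M : 'M_n => M i i) UU.
rewrite !mxE eqxx (bigD1 j) //= !mxE -normCK => E.
rewrite -(@expr_le1 _ 2) //; apply: le_trans (_ : _ <= true%:R) _; last by [].
rewrite -E lerDl.
by apply: sumr_ge0 => k _; rewrite !mxE mul_conjC_ge0.
Qed.

(** Compactness of the unitary group: the entries are bounded by 1, and the
    coefficients of the action are polynomials in the entries and their
    conjugates. *)
Lemma unitary_limit (X : Type) (F : set_system X) (U : X -> 'M[C]_n) :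
  UltraFilter F -> F [set x | U x \is unitarymx] ->
  exists2 U0, U0 \is unitarymx &
    forall z y, cvgF F (fun x => ip (act (U x) z) y) (ip (act U0 z) y).
Proof.
move=> FU UF; have FF := @ultra_proper _ _ FU.
have /choice[V HV] : forall p : 'I_n * 'I_n, exists l, cvgF F (fun x => U x p.1 p.2) l.
  move=> p; apply: (@Clim _ F _ 1).
  by apply: filterS UF => x /= Ux; exact: unitary_entry.
pose U0 : 'M[C]_n := \matrix_(i, j) V (i, j).
have lU i j : cvgF F (fun x => U x i j) (U0 i j) by rewrite mxE; exact: HV (i, j).
have U0U : U0 \is unitarymx.
  have mulE (M : 'M[C]_n) i j : (M *m (M ^t*)%sesqui) i j = \sum_k M i k * (M j k)^*.
    by rewrite mxE; apply: eq_bigr => k _; rewrite [in LHS]mxE [in LHS]mxE.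
  apply/unitarymxP/matrixP => i j; rewrite mulE mxE.
  apply: (@cvgF_unique _ _ F FF (fun x => (U x *m (U x ^t*)%sesqui) i j)).
    apply: (@cvgF_near _ _ _ FF (fun x => \sum_k U x i k * (U x j k)^*)).
      by apply: filterS filterT => x _ /=; rewrite mulE.
    by apply: cvgF_sum => // k; exact: (cvgFM FF (lU i k) (cvgF_conj FF (lU j k))).
  apply: (@cvgF_near _ _ _ FF (fun x => (i == j)%:R)); last exact: cvgF_cst.
  by apply: filterS UF => x /= /unitarymxP ->; rewrite mxE.
exists U0 => // z y.
have lk (M : X -> 'M[C]_n) M0 s t : (forall i j, cvgF F (fun x => M x i j) ((M0 : 'M[C]_n) i j)) ->
    cvgF F (fun x => kron (M x) s t) (kron M0 s t).
  move=> H; elim: s t => [|a s IH] [|b t] /=; try exact: cvgF_cst.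
  exact: cvgFM.
have lz s t : cvgF F (fun x => (act (U x) z)@_(bw s t)) ((act U0 z)@_(bw s t)).
  rewrite actE unitary_invT //.
  apply: (@cvgF_near _ _ _ FF (fun x => \sum_(s' : (size s).-tuple 'I_n) \sum_(t' : (size t).-tuple 'I_n)
    kron (U x) s s' * kron (map_mx Num.conj (U x)) t t' * z@_(bw s' t'))).
    by apply: filterS UF => x /= Ux; rewrite actE unitary_invT.
  apply: cvgF_sum => // s'; apply: cvgF_sum => // t'; apply: cvgFM => //; last exact: cvgF_cst.
  apply: cvgFM => //; first exact: lk.
  rewrite kron_conj; apply: (@cvgF_near _ _ _ FF (fun x => (kron (U x) t t')^*)).
    by apply: filterS filterT => x _ /=; rewrite kron_conj.
  by apply: cvgF_conj => //; exact: lk.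
move: y; apply: tensor_ind => [|a s t y IH].
  rewrite ip0r; apply: (@cvgF_near _ _ _ FF (fun x => 0)); last exact: cvgF_cst.
  by apply: filterS filterT => x _ /=; rewrite ip0r.
rewrite ipPr ip_ebr; apply: (@cvgF_near _ _ _ FF (fun x => a^* * (act (U x) z)@_(bw s t) + ip (act (U x) z) y)).
  by apply: filterS filterT => x _ /=; rewrite ipPr ip_ebr.
by apply: cvgFD => //; exact: cvgFZ.
Qed.

End UnitaryCompact.

(** * An invariant mean on the unitary group *)

Section Mean.
Variables (C : numClosedFieldType) (n : nat).
Hypotheses (Clim : bounded_limits C) (Cmin : near_minima C).
Local Notation T := (mtensor C n).
Local Notation M := 'M[C]_n.
Implicit Types (s : seq M) (x y : T) (f : M -> C) (l : seq T).

(** Lists may have repetitions, so that these averages are the rational convex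
    combinations of values of f. *)
Definition avg s f : C := (size s)%:R^-1 * \sum_(U <- s) f U.
Definition avgT s x : T := (size s)%:R^-1 *: \sum_(U <- s) act U x.
Definition unitary_list s := (s != [::]) && all (fun U => U \is unitarymx) s.

Lemma unitary_list_size s : unitary_list s -> (size s)%:R != 0 :> C.
Proof. by case/andP => s0 _; rewrite pnatr_eq0 size_eq0. Qed.

Lemma ip_suml (I : Type) (r : seq I) (F : I -> T) y :
  ip (\sum_(i <- r) F i) y = \sum_(i <- r) ip (F i) y.
Proof.
elim: r => [|i r IH]; first by rewrite !big_nil ip0l.
by rewrite !big_cons -[F i]scale1r ipPl mul1r scale1r IH.
Qed.

Lemma ipZl a x y : ip (a *: x) y = a * ip x y.
Proof. by rewrite -[a *: x]addr0 ipPl ip0l addr0. Qed.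
Lemma ipDl x x' y : ip (x + x') y = ip x y + ip x' y.
Proof. by rewrite -[x]scale1r ipPl mul1r scale1r. Qed.
Lemma ipDr x y y' : ip x (y + y') = ip x y + ip x y'.
Proof. by rewrite -[y]scale1r ipPr conjC1 mul1r scale1r. Qed.
Lemma ipBl x x' y : ip (x - x') y = ip x y - ip x' y.
Proof. by rewrite ipDl -scaleN1r ipZl mulN1r. Qed.
Lemma ipZr a x y : ip x (a *: y) = a^* * ip x y.
Proof. by rewrite -[a *: y]addr0 ipPr ip0r addr0. Qed.
Lemma ipBr x y y' : ip x (y - y') = ip x y - ip x y'.
Proof. by rewrite ipDr -scaleN1r ipZr rmorphN1 mulN1r. Qed.

Lemma ip_avgT s x y : ip (avgT s x) y = avg s (fun U => ip (act U x) y).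
Proof. by rewrite /avgT ipZl ip_suml. Qed.

Lemma act_sum (I : Type) (r : seq I) (F : I -> T) (U : M) :
  act U (\sum_(i <- r) F i) = \sum_(i <- r) act U (F i).
Proof.
elim: r => [|i r IH]; first by rewrite !big_nil (lin0 (@act_lin _ _ U)).
by rewrite !big_cons -[F i]scale1r actP scale1r IH scale1r.
Qed.

Lemma unitary_list_double (g : M) s : g \is unitarymx -> unitary_list s -> unitary_list (s ++ map (mulmx g) s).
Proof.
move=> gU /andP[s0 sU]; apply/andP; split; first by case: s s0 {sU}.
rewrite all_cat sU all_map; apply/allP => U Us; rewrite [preim _ _ _]/=.
apply: mul_unitarymx gU _; exact: (allP sU).
Qed.

Lemma avgT_double (g : M) s x : g \is unitarymx -> unitary_list s ->
  avgT (s ++ map (mulmx g) s) x = 2^-1 *: (avgT s x + act g (avgT s x)).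
Proof.
move=> gU su; rewrite /avgT big_cat big_map size_cat size_map /=.
rewrite (linZ (@act_lin _ _ g)) act_sum -scalerDr scalerA -invfM mulr_natl addnn -muln2 natrM mulr_natr; congr (_ *: (_ + _)).
case/andP: su => _ sU; apply: eq_big_seq => U Us.
by rewrite act_comp // unitary_unit // (allP sU).
Qed.

Lemma parallelogram x y : ip (x - y) (x - y) = 2 * ip x x + 2 * ip y y - ip (x + y) (x + y).
Proof. by rewrite !ipBl !ipBr !ipDl !ipDr; ring. Qed.

Lemma midpoint x y : ip (2^-1 *: (x + y)) (2^-1 *: (x + y)) = 4^-1 * ip (x + y) (x + y).
Proof.
by rewrite ipZl ipZr (conj_Creal (_ : 2^-1 \is Num.real)) ?realV ?realn // mulrA -invfM -natrM.
Qed.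

(** The quantity to be minimized over s: at a minimum all averages of orbits of
    elements of l would be invariant. *)
Definition energy l s : C := \sum_(x <- l) ip (avgT s x) (avgT s x).

Lemma energy_ge0 l s : 0 <= energy l s.
Proof. by apply: sumr_ge0 => x _; exact: ip_ge0. Qed.

(** By the parallelogram law, if averaging s with its translate by g cannot lower
    the energy much, then g almost fixes the averages over s. *)
Lemma energy_double l s (g : M) : g \is unitarymx -> unitary_list s ->
  \sum_(x <- l) ip (avgT s x - act g (avgT s x)) (avgT s x - act g (avgT s x)) =
  4 * (energy l s - energy l (s ++ map (mulmx g) s)).
Proof.
move=> gU su; rewrite /energy -sumrB mulr_sumr; apply: eq_bigr => x _.
rewrite (avgT_double x gU su); move: (avgT s x) => a.
rewrite parallelogram (ip_act2 _ _ gU) midpoint.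
have four0 : (4 : C) != 0 by rewrite pnatr_eq0.
by rewrite mulrBr mulVKf // -mulrDl -natrD.
Qed.

Definition almost_invariant l (e : C) : set (seq M) :=
  [set s | unitary_list s /\ forall x g, x \in l -> g \is unitarymx ->
    ip (avgT s x - act g (avgT s x)) (avgT s x - act g (avgT s x)) <= e].

Lemma almost_invariant_ex l (e : C) : 0 < e -> almost_invariant l e !=set0.
Proof.
move=> e0; have e4 : 0 < e / 4 by rewrite divr_gt0 // ltr0n.
have [s su Hs] : exists2 s, unitary_list s & forall s', unitary_list s' -> energy l s <= energy l s' + e / 4.
  apply: (Cmin (P := [set s | unitary_list s])) => //; last exact: energy_ge0.
  by exists [:: 1%:M]; rewrite /= /unitary_list /= unitary1.
 exists s; split=> // x g xl gU.
have := Hs _ (unitary_list_double gU su); rewrite -lerBlDl => H.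
have := energy_double l gU su.
rewrite (big_rem x xl) /= => E.
apply: (@le_trans _ _ (4 * (energy l s - energy l (s ++ map (mulmx g) s)))).
  by rewrite -E lerDl; apply: sumr_ge0 => y _; exact: ip_ge0.
by rewrite mulrC -ler_pdivlMr // ltr0n.
Qed.

(** The families of almost invariant lists are directed, so that one ultrafilter
    serves all tensors and all tolerances. *)
Lemma mean_filter : exists2 F : set_system (seq M), UltraFilter F &
  forall l e, 0 < e -> F (almost_invariant l e).
Proof.
pose D := [set p : seq T * C | 0 < p.2].
pose B (p : seq T * C) := almost_invariant p.1 p.2.
have BF : Filter (filter_from D B).
  apply: filter_from_filter; first by exists ([::], 1); exact: ltr01.
  move=> [l e] [l' e'] /= e0 e'0; exists (l ++ l', Num.min e e') => /=.
    by rewrite /Num.min; case: ifP.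
  have re : Num.min e e' <= e /\ Num.min e e' <= e'.
    have [H|H] := real_leP (gtr0_real e0) (gtr0_real e'0); split=> //; exact: ltW.
  move=> s [su Hs]; split; split=> // x g xl gU.
    by apply: le_trans (Hs x g _ gU) re.1; rewrite mem_cat xl.
  by apply: le_trans (Hs x g _ gU) re.2; rewrite mem_cat xl orbT.
have BP : ProperFilter (filter_from D B).
  by apply: filter_from_proper => // -[l e] e0; exact: almost_invariant_ex.
have [F [FU BsF]] := ultraFilterLemma BP.
exists F => // l e e0; apply: BsF; by exists (l, e).
Qed.

Definition ubounded f := exists B : C, forall U, U \is unitarymx -> `|f U| <= B.

Lemma ubounded_cst c : ubounded (fun _ => c).
Proof. by exists `|c|. Qed.
Lemma uboundedD f h : ubounded f -> ubounded h -> ubounded (fun U => f U + h U).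
Proof.
move=> [B HB] [B' HB']; exists (B + B') => U UU.
apply: le_trans (ler_normD _ _) _; apply: lerD; [exact: HB|exact: HB'].
Qed.
Lemma uboundedM f h : ubounded f -> ubounded h -> ubounded (fun U => f U * h U).
Proof.
move=> [B HB] [B' HB']; exists (B * B') => U UU.
rewrite normrM; apply: ler_pM => //; [exact: HB|exact: HB'].
Qed.
Lemma ubounded_ip x y : ubounded (fun U => ip (act U x) y).
Proof.
move: y; apply: tensor_ind => [|a u v y [B HB]].
  by exists 0 => U _; rewrite ip0r normr0.
exists (`|a| * (ip x x + 1) + B) => U UU; rewrite ipPr ip_ebr.
apply: le_trans (ler_normD _ _) _; apply: lerD; last exact: HB.
rewrite normrM norm_conjC; apply: ler_wpM2l => //.
set c := _@_ _; have c2 : `|c| ^+ 2 <= ip x x.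
  by apply: le_trans (ip_coef_le _ _ _) _; rewrite ip_act2.
have [c1|c1] := real_leP (normr_real c) (real1 _).
  by apply: le_trans c1 _; rewrite lerDr ip_ge0.
apply: (@le_trans _ _ (`|c| ^+ 2)); first by rewrite expr2 ler_peMl // ltW.
by apply: le_trans c2 _; rewrite lerDl.
Qed.

(** The substitute for the Haar integral: the limit along this ultrafilter of
    the averages over finite lists.  Invariance is claimed for matrix coefficients
    only, where almost invariance of the averaged tensors gives it. *)
Lemma mean_exists : exists E : (M -> C) -> C,
  [/\ forall a f h, ubounded f -> ubounded h -> E (fun U => a * f U + h U) = a * E f + E h,
      forall f, ubounded f -> (forall U, U \is unitarymx -> 0 <= f U) -> 0 <= E f,
      E (fun _ => 1) = 1
    & forall x y g, g \is unitarymx ->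
       E (fun U => ip (act g (act U x)) y) = E (fun U => ip (act U x) y)].
Proof.
have [F FU FI] := mean_filter; have FF := @ultra_proper _ _ FU.
have Fu : F [set s | unitary_list s].
  by apply: filterS (FI [::] 1 ltr01) => s [].
have avg_le s f (B : C) : unitary_list s -> (forall U, U \is unitarymx -> `|f U| <= B) -> `|avg s f| <= B.
  move=> su HB; rewrite /avg normrM normfV normr_nat.
  rewrite mulrC ler_pdivrMr; last by rewrite lt_def unitary_list_size //= ler0n.
  apply: le_trans (ler_norm_sum _ _ _) _.
  case/andP: su => _ sU.
  rewrite -[size s]mul1n -sum1_size mul1n natr_sum mulr_sumr !big_seq.
  apply: ler_sum => U Us; rewrite mulr1; exact/HB/(allP sU).
have limE f : exists l : C, ubounded f -> cvgF F (fun s => avg s f) l.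
  have [[B HB]|NB] := pselect (ubounded f); last by exists 0.
  have [l Hl] : exists l : C, cvgF F (fun s => avg s f) l.
    by apply: (Clim (B := B)); apply: filterS Fu => s su /=; exact: avg_le.
  by exists l.
have [E HE] := choice limE; exists E; split.
- move=> a f h fB hB; have afB : ubounded (fun U => a * f U + h U).
    by apply: uboundedD => //; apply: uboundedM => //; exact: ubounded_cst.
  apply: (@cvgF_unique _ _ F FF _ _ _ (HE _ afB)).
  apply: cvgF_near (cvgFD FF (cvgFZ FF a (HE _ fB)) (HE _ hB)).
  apply: filterS filterT => s _ /=.
  by rewrite /avg big_split /= -mulr_sumr mulrDr mulrCA.
- move=> f fB f0; apply: (@cvgF_ge0 _ _ F FF _ _ _ (HE _ fB)).
  apply: filterS Fu => s /andP[_ su] /=; rewrite /avg mulr_ge0 ?invr_ge0 ?ler0n // big_seq.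
  by apply: sumr_ge0 => U Us; apply/f0/(allP su).
- apply: (@cvgF_unique _ _ F FF _ _ _ (HE _ (ubounded_cst 1))).
  apply: cvgF_near (cvgF_cst FF 1); apply: filterS Fu => s su /=.
  have -> : avg s (fun _ => 1) = (size s)%:R^-1 * (size s)%:R.
    by congr (_ * _); rewrite -sum1_size natr_sum.
  by rewrite mulVf // unitary_list_size.
move=> x y g gU.
pose d s := avgT s x - act g (avgT s x).
have dcoef u v : cvgF F (fun s => (d s)@_(bw u v)) 0.
  move=> e e0; apply: filterS (FI [:: x] (e ^+ 2 / 2) _) => [s [su Hs]|]; last first.
    by rewrite divr_gt0 ?exprn_gt0 ?ltr0n.
  have := Hs x g (mem_head _ _) gU => H; rewrite /= subr0.
  rewrite -(@ltr_pXn2r _ 2) ?nnegrE // ?ltW //.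
  apply: le_lt_trans (ip_coef_le _ u v) _; apply: le_lt_trans H _.
  by rewrite ltr_pdivrMr ?ltr0n // ltr_pMr ?exprn_gt0 // ltr1n.
have dip : cvgF F (fun s => ip (d s) y) 0.
  move: y; apply: tensor_ind => [|a u v y IH].
    by apply: cvgF_near (cvgF_cst FF 0); apply: filterS filterT => s _ /=; rewrite ip0r.
  have := cvgFD FF (cvgFZ FF a^* (dcoef u v)) IH; rewrite mulr0 addr0.
  by apply: cvgF_near; apply: filterS filterT => s _ /=; rewrite ipPr ip_ebr.
have gE s : ip (act g (avgT s x)) y = avg s (fun U => ip (act g (act U x)) y).
  by rewrite ip_act // ip_avgT /avg; congr (_ * _); apply: eq_bigr => U _; rewrite [RHS]ip_act.
have gB : ubounded (fun U => ip (act g (act U x)) y).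
  have [B HB] := ubounded_ip x (act (invmx g) y); exists B => U UU; rewrite (ip_act _ _ gU); exact: HB.
apply: (@cvgF_unique _ _ F FF _ _ _ (HE _ gB)).
have := cvgFD FF (HE _ (ubounded_ip x y)) (cvgFZ FF (-1) dip); rewrite mulr0 addr0.
apply: cvgF_near; apply: filterS filterT => s _ /=.
by rewrite /d ipBl gE ip_avgT; ring.
Qed.

End Mean.

(** * Orthogonal projection and a growth estimate *)

Section OrthogonalDecomposition.
Variables (C : numClosedFieldType) (n : nat).
Local Notation T := (mtensor C n).
Implicit Types (x y z w : T) (A : set T).

(** Gaussian elimination: coordinates are treated one at a time, and an element
    of A is recorded whenever a new coordinate is not yet eliminated.  The last
    two clauses say that a' is a combination of bs and agrees with a on ms. *)
Lemma finite_spanning A (ms : seq (seq 'I_n * seq 'I_n)) :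
  (forall a x y, A x -> A y -> A (a *: x + y)) -> A 0 ->
  exists2 bs : seq T, {in bs, forall b, A b} &
    forall a, A a -> exists a', [/\ A a',
      forall w, {in bs, forall b, ip w b = 0} -> ip w a' = 0 &
      {in ms, forall m, (a - a')@_(bw m.1 m.2) = 0}].
Proof.
move=> AP A0; elim: ms => [|m ms [bs bsA Hbs]].
  by exists [::] => // a Aa; exists 0; split=> // w _; rewrite ip0r.
have AB x y : A x -> A y -> A (x - y).
  by move=> Ax Ay; rewrite addrC -scaleN1r; exact: AP.
have [[c [Ac cms cm]]|NC] := pselect (exists c, [/\ A c,
    {in ms, forall m', c@_(bw m'.1 m'.2) = 0} & c@_(bw m.1 m.2) != 0]).
  exists (c :: bs) => [b|a Aa]; first by rewrite inE => /orP[/eqP ->|/bsA].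
  have [a' [Aa' wa' a'ms]] := Hbs a Aa.
  pose r := (a - a')@_(bw m.1 m.2) / c@_(bw m.1 m.2).
  exists (r *: c + a'); split; first exact: AP.
    move=> w wbs; rewrite ipPr (wbs c) ?mem_head // mulr0 add0r wa' // => b bb.
    by apply: wbs; rewrite inE bb orbT.
  move=> m'; rewrite inE opprD addrCA tcoefD -scaleNr tcoefZ => /orP[/eqP ->|m'ms].
    by rewrite mulNr divfK // addNr.
  by rewrite a'ms // cms // mulr0 addr0.
exists bs => // a Aa; have [a' [Aa' wa' a'ms]] := Hbs a Aa.
exists a'; split=> // m'; rewrite inE => /orP[/eqP -> {m'}|]; last exact: a'ms.
apply/eqP/negPn/negP => H; apply: NC; exists (a - a'); split=> //; exact: AB.
Qed.

(** Gram-Schmidt.  The last clause records that a is a combination of bs. *)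
Lemma orthogonal_projection A (bs : seq T) :
  (forall a x y, A x -> A y -> A (a *: x + y)) -> A 0 -> {in bs, forall b, A b} ->
  forall z, exists a, [/\ A a, {in bs, forall b, ip (z - a) b = 0} &
     forall w, {in bs, forall b, ip w b = 0} -> ip w a = 0].
Proof.
move=> AP A0; elim: bs => [|b bs IH] bsA z.
  by exists 0; split=> // w _; rewrite ip0r.
have {}IH := IH (fun c cb => bsA c (mem_behead (s := b :: bs) cb)).
have [az [Aaz zo waz]] := IH z; have [ab [Aab bo wab]] := IH b.
have Ab : A b by apply: bsA; rewrite mem_head.
pose b1 := b - ab; pose r := ip (z - az) b1 / ip b1 b1.
have Ab1 : A b1 by rewrite /b1 addrC -scaleN1r; exact: AP.
exists (r *: b1 + az); split; first exact: AP.
  have zb1 : ip (z - (r *: b1 + az)) b1 = 0.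
    have -> : z - (r *: b1 + az) = - r *: b1 + (z - az).
      by rewrite opprD addrCA scaleNr.
    rewrite ipPl; have [b10|b10] := eqVneq (ip b1 b1) 0.
      by rewrite (ip_eq0 b10) !ip0r mulr0 addr0.
    by rewrite mulNr divfK // addNr.
  have zbs : {in bs, forall c, ip (z - (r *: b1 + az)) c = 0}.
    move=> c cb; have -> : z - (r *: b1 + az) = - r *: b1 + (z - az).
      by rewrite opprD addrCA scaleNr.
    by rewrite ipPl (bo c) // (zo c) // mulr0 addr0.
  move=> c; rewrite inE => /orP[/eqP ->|]; last exact: zbs.
  have -> : b = 1 *: b1 + ab by rewrite scale1r subrK.
  by rewrite ipPr zb1 mulr0 add0r wab.
move=> w wbs; have wbs' : {in bs, forall c, ip w c = 0}.
  by move=> c cb; apply: wbs; rewrite inE cb orbT.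
rewrite ipPr (waz w wbs') addr0 /b1 -scaleN1r addrC ipPr (wab w wbs') (wbs b) ?mem_head //.
by rewrite mulr0 addr0 mulr0.
Qed.

Lemma bidegree_decomposition A k l z : ccalg A -> bidegree k l z ->
  exists a, [/\ A a, bidegree k l a & forall c, A c -> bidegree k l c -> ip (z - a) c = 0].
Proof.
move=> cA zkl; pose B := [set x | A x /\ bidegree k l x].
have BP a x y : B x -> B y -> B (a *: x + y).
  by move=> [Ax xb] [Ay yb]; split; [exact: ccP|exact: bidegreeD].
have B0 : B 0 by split; [exact: cc0|exact: bidegree0].
pose ms := [seq (tval p.1, tval p.2) | p : k.-tuple 'I_n * l.-tuple 'I_n].
have [bs bsB Hbs] := finite_spanning ms BP B0.
have [a [[Aa ab] za _]] := orthogonal_projection BP B0 bsB z.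
exists a; split=> // c Ac cb; have [c' [[_ c'b] wc' cc']] := Hbs c (conj Ac cb).
suff -> : c = c' by exact: wc'.
apply/tensorP => s t; apply/eqP; rewrite -subr_eq0; apply/eqP.
have [/andP[sk tl]|] := boolP ((size s == k) && (size t == l)).
  rewrite -mcoeffB; apply: (cc' (s, t)); apply/mapP.
  by exists (Tuple sk, Tuple tl); rewrite ?mem_enum.
by rewrite negb_and => H; rewrite (bidegree_coef0 cb H) (bidegree_coef0 c'b H) subrr.
Qed.

End OrthogonalDecomposition.

(** The recursion forces m to decay geometrically with ratio 1 - al / be, and
    the lower bounds allow any ratio below 1. *)
Lemma no_geometric_gap (R : realType) (m : nat -> R) (al be : R) :
  0 < al -> al < be -> m 0%N = 1 -> (forall N, 0 <= m N) ->
  (forall N, (al - be) * m N + be * m N.+1 <= 0) ->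
  (forall rho, 0 < rho -> rho < 1 -> exists K : nat, forall N, rho ^+ N <= K%:R * m N) -> False.
Proof.
move=> al0 albe m0 mge0 mrec mlow.
have be0 : 0 < be by exact: lt_trans albe.
pose ka := (be - al) / be.
have ka0 : 0 < ka by rewrite divr_gt0 // subr_gt0.
have ka1 : ka < 1 by rewrite ltr_pdivrMr // mul1r ltrBlDr ltrDl.
have mka N : m N <= ka ^+ N.
  elim: N => [|N IH]; first by rewrite m0.
  rewrite exprS; apply: (@le_trans _ _ (ka * m N)); last by rewrite ler_pM2l.
  by rewrite /ka mulrAC ler_pdivlMr //; have := mrec N; nra.
have [K' HK] := mlow ((1 + ka) / 2) ltac:(lra) ltac:(lra); pose K : R := K'%:R; rewrite -/K in HK.
(* The midpoint rho of ka and 1 is ka (1 + eta), and Bernoulli's inequality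
   makes (1 + eta)^N unbounded. *)
pose eta := (1 - ka) / (2 * ka).
have eta0 : 0 < eta by rewrite divr_gt0 // ?subr_gt0 // mulr_gt0.
have rE : (1 + ka) / 2 = ka * (1 + eta) by rewrite /eta; field; lra.
have bern N : 1 + N%:R * eta <= (1 + eta) ^+ N.
  elim: N => [|N IH]; first by rewrite mul0r addr0.
  rewrite exprS; apply: (@le_trans _ _ ((1 + eta) * (1 + N%:R * eta))); last first.
    by rewrite ler_pM2l // addr_gt0.
  rewrite -natr1; have N0 : 0 <= N%:R :> R by []. nra.
have K0 : 0 <= K by exact: ler0n.
have bound N : (1 + eta) ^+ N <= K.
  have kN : 0 < ka ^+ N by rewrite exprn_gt0.
  have := HK N; rewrite rE exprMn => H.
  rewrite -(ler_pM2l kN); apply: le_trans H _; rewrite mulrC.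
  by rewrite ler_wpM2r.
have := bound (Num.bound (K / eta)); have := bern (Num.bound (K / eta)).
have : K / eta < (Num.bound (K / eta))%:R by rewrite archi_boundP // divr_ge0 // ltW.
rewrite ltr_pdivrMr //; lra.
Qed.

Definition no_gap (K : numFieldType) := forall (m : nat -> K) (al be : K),
  0 < al -> al < be -> m 0%N = 1 -> (forall N, 0 <= m N) ->
  (forall N, (al - be) * m N + be * m N.+1 <= 0) ->
  (forall rho, 0 < rho -> rho < 1 -> exists k : nat, forall N, rho ^+ N <= k%:R * m N) -> False.

Lemma no_gap_complex (R : realType) : no_gap R[i].
Proof.
move=> m al be al0 albe m0 mge0 mrec mlow.
have reE (c : R[i]) : 0 <= c -> c = (complex.Re c)%:C%C.
  by move=> c0; apply/esym/RRe_real/ger0_real.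
have alE := reE _ (ltW al0); have beE := reE _ (ltW (lt_trans al0 albe)).
have mE N := reE _ (mge0 N).
apply: (@no_geometric_gap R (fun N => complex.Re (m N)) (complex.Re al) (complex.Re be)).
- by rewrite -ltcR -alE.
- by rewrite -ltcR -alE -beE.
- by rewrite m0.
- by move=> N; rewrite -lecR -mE.
- by move=> N; rewrite -lecR rmorphD !rmorphM rmorphB /= -alE -beE -!mE.
move=> rho r0 r1; have [||k Hk] := mlow rho%:C%C; rewrite ?ltcR //.
exists k => N; rewrite -lecR rmorphXn rmorphM /= -mE rmorph_nat; exact: Hk.
Qed.

(** * Means of matrix coefficients *)

Section Density.
Variables (C : numClosedFieldType) (n : nat).
Local Notation T := (mtensor C n).
Local Notation M := 'M[C]_n.
Implicit Types (x y z a b : T) (U V g : M) (f h : M -> C).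

Variable E : (M -> C) -> C.
Hypothesis Elin : forall c f h, ubounded f -> ubounded h -> E (fun U => c * f U + h U) = c * E f + E h.
Hypothesis Epos : forall f, ubounded f -> (forall U, U \is unitarymx -> 0 <= f U) -> 0 <= E f.
Hypothesis E1 : E (fun _ => 1) = 1.
Hypothesis Einv : forall x y g, g \is unitarymx ->
  E (fun U => ip (act g (act U x)) y) = E (fun U => ip (act U x) y).

(** The mean only sees the values on unitary matrices, by positivity. *)
Lemma E_ext f h : ubounded f -> ubounded h -> (forall U, U \is unitarymx -> f U = h U) -> E f = E h.
Proof.
move=> fB hB fh; have le f' h' : ubounded f' -> ubounded h' -> (forall U, U \is unitarymx -> f' U = h' U) -> E f' <= E h'.
  move=> f'B h'B fh'; rewrite -subr_ge0 addrC -mulN1r -Elin //; apply: Epos.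
    by apply: uboundedD => //; apply: uboundedM => //; exact: ubounded_cst.
  by move=> U UU; rewrite fh' // mulN1r addNr.
by apply: le_anti; rewrite !le // => U UU; rewrite fh.
Qed.

Lemma E0 : E (fun _ => 0) = 0.
Proof.
have := Elin (-1) (ubounded_cst _ 1) (ubounded_cst _ 1); rewrite E1 mulr1 addNr => H; rewrite -[RHS]H.
by congr E; apply/funext => U; rewrite mulr1 addNr.
Qed.

Lemma ubounded_sum (I : eqType) (r : seq I) (f : I -> M -> C) : {in r, forall i, ubounded (f i)} ->
  ubounded (fun U => \sum_(i <- r) f i U).
Proof.
elim: r => [|i r IH] H.
  by exists 0 => U _; rewrite big_nil normr0.
have [B HB] : ubounded (fun U => \sum_(j <- r) f j U) by apply: IH => j jr; apply: H; rewrite inE jr orbT.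
have [B' HB'] := H i (mem_head _ _); exists (B' + B) => U UU; rewrite big_cons.
apply: le_trans (ler_normD _ _) _; apply: lerD; [exact: HB'|exact: HB].
Qed.

Lemma EZ c f : ubounded f -> E (fun U => c * f U) = c * E f.
Proof.
move=> fB; rewrite -[RHS]addr0 -E0 -Elin //; last exact: ubounded_cst.
by congr E; apply/funext => U; rewrite addr0.
Qed.

Lemma E_sum (I : eqType) (r : seq I) (f : I -> M -> C) : {in r, forall i, ubounded (f i)} ->
  E (fun U => \sum_(i <- r) f i U) = \sum_(i <- r) E (f i).
Proof.
elim: r => [|i r IH] H.
  by rewrite big_nil -[RHS]E0; congr E; apply/funext => U; rewrite big_nil.
have Hr : {in r, forall j, ubounded (f j)} by move=> j jr; apply: H; rewrite inE jr orbT.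
have Hi := H i (mem_head _ _).
rewrite big_cons -(IH Hr) -[E (f i)]mul1r -Elin //; last exact: ubounded_sum.
by congr E; apply/funext => U; rewrite big_cons mul1r.
Qed.

Lemma ubounded_coef x s t : ubounded (fun U => (act U x)@_(bw s t)).
Proof.
have [B HB] := ubounded_ip x (eb C s t); exists B => U UU.
by rewrite -ip_ebr; exact: HB.
Qed.

Lemma ip_words k l x y : bidegree k l y ->
  ip x y = \sum_(u : k.-tuple 'I_n) \sum_(v : l.-tuple 'I_n) x@_(bw u v) * (y@_(bw u v))^*.
Proof.
move=> yb; rewrite ipC -[RHS]conjCK; congr (_^*).
transitivity (\sum_(u : k.-tuple 'I_n) \sum_(v : l.-tuple 'I_n) y@_(bw u v) * (x@_(bw u v))^*).
  move: y yb; apply: (@bidegree_ext _ _ C^o _ _ (fun x0 => ip x0 x)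
    (fun y => \sum_(u : k.-tuple 'I_n) \sum_(v : l.-tuple 'I_n) y@_(bw u v) * (x@_(bw u v))^*)).
  - exact: ip_linl.
  - move=> c y y'; rewrite scaler_sumr -big_split; apply: eq_bigr => u _ /=.
    rewrite scaler_sumr -big_split; apply: eq_bigr => v _ /=.
    by rewrite tcoefD tcoefZ mulrDl -mulrA.
  move=> s t sk tl; rewrite ip_ebl.
  under eq_bigr => u _.
    under eq_bigr => v _ do rewrite coef_eb -mulnb natrM mulrC mulrA.
    rewrite (big_tuple_pick l t (fun v => (x@_(bw u v))^* * (s == u)%:R)) tl eqxx.
    over.
  by rewrite (big_tuple_pick k s (fun u => (x@_(bw u t))^*)) sk eqxx.
rewrite rmorph_sum; apply: eq_bigr => u _; rewrite rmorph_sum; apply: eq_bigr => v _.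
by rewrite rmorphM /= conjCK mulrC.
Qed.

(** The mean of the orbit of x has the coefficients of an invariant tensor, to
    which the first fundamental theorem applies. *)
Lemma mean_coef_eq0 k l x y : bidegree k l y ->
  (forall sg : 'S_k, k = l -> ip y (Jperm C n sg) = 0) -> E (fun U => ip (act U x) y) = 0.
Proof.
move=> yb yJ; pose f s t := E (fun U => (act U x)@_(bw s t)).
have finv : word_invariant k l f.
  move=> g gU s t sk tl.
  have -> : f s t = E (fun U => ip (act g (act U x)) (eb C s t)).
    by rewrite Einv //; congr E; apply/funext => U; rewrite ip_ebr.
  have -> : (fun U => ip (act g (act U x)) (eb C s t)) = (fun U =>
      \sum_(u : k.-tuple 'I_n) \sum_(v : l.-tuple 'I_n)
        kron g s u * kron (map_mx Num.conj g) t v * (act U x)@_(bw u v)).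
    apply/funext => U; rewrite ip_ebr actE unitary_invT // (big_tuple_cast (fun s' =>
      \sum_(t' : (size t).-tuple 'I_n) kron g s s' * kron (map_mx Num.conj g) t t' * (act U x)@_(bw s' t')) sk).
    by apply: eq_bigr => u _; rewrite (big_tuple_cast (fun t' => kron g s u * kron (map_mx Num.conj g) t t' * (act U x)@_(bw u t')) tl).
  have B c u v : ubounded (fun U => c * (act U x)@_(bw u v)).
    by apply: uboundedM; [exact: ubounded_cst|exact: ubounded_coef].
  rewrite E_sum => [|u _]; last by apply: ubounded_sum.
  apply: eq_bigr => u _; rewrite E_sum //; apply: eq_bigr => v _.
  by rewrite EZ //; exact: ubounded_coef.
rewrite -[RHS](fft_orth finv yJ).
have -> : (fun U => ip (act U x) y) = (fun U => \sum_(u : k.-tuple 'I_n) \sum_(v : l.-tuple 'I_n)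
   (y@_(bw u v))^* * (act U x)@_(bw u v)).
  apply/funext => U; rewrite (ip_words _ yb).
  by apply: eq_bigr => u _; apply: eq_bigr => v _; rewrite mulrC.
have B c u v : ubounded (fun U => c * (act U x)@_(bw u v)).
  by apply: uboundedM; [exact: ubounded_cst|exact: ubounded_coef].
rewrite E_sum => [|u _]; last by apply: ubounded_sum.
apply: eq_bigr => u _; rewrite E_sum //; apply: eq_bigr => v _.
by rewrite EZ 1?mulrC //; exact: ubounded_coef.
Qed.

Variable A : set T.
Hypotheses (cA : ccalg A) (AI : A tensI).

(** The functions obtained from elements of A.  They form an algebra because A is
    one; they are constant on the cosets of the stabilizer of A, and their means
    against the orbit of a tensor orthogonal to A vanish. *)
Inductive matcoef : (M -> C) -> Prop :=
| matcoef_ip k l b b' : A b -> A b' -> bidegree k l b -> bidegree k l b' ->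
    matcoef (fun U => ip (act U b) b')
| matcoef_lin c f h : matcoef f -> matcoef h -> matcoef (fun U => c * f U + h U).

Lemma matcoef_Bd f : matcoef f -> ubounded f.
Proof.
elim=> [k l b b' _ _ _ _|c f' h' _ IHf _ IHh]; first exact: ubounded_ip.
by apply: uboundedD => //; apply: uboundedM => //; exact: ubounded_cst.
Qed.

Lemma matcoef1 : matcoef (fun _ => 1).
Proof.
have -> : (fun _ : M => 1) = (fun U => ip (act U 1) 1 : C).
  by apply/funext => U; rewrite act1 one_eb ip_ebl coef_eb !eqxx conjC1.
by apply: (@matcoef_ip 0 0); [exact: cc1|exact: cc1|exact: bidegree1|exact: bidegree1].
Qed.

Lemma matcoef0 : matcoef (fun _ => 0).
Proof.
have -> : (fun _ : M => 0) = (fun U => -1 * 1 + 1 : C) by apply/funext => U; rewrite mulr1 addNr.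
apply: matcoef_lin; exact: matcoef1.
Qed.

Lemma matcoefZ c f : matcoef f -> matcoef (fun U => c * f U).
Proof.
move=> fm; have -> : (fun U => c * f U) = (fun U => c * f U + 0) by apply/funext => U; rewrite addr0.
by apply: matcoef_lin => //; exact: matcoef0.
Qed.

Lemma matcoefD f h : matcoef f -> matcoef h -> matcoef (fun U => f U + h U).
Proof.
move=> fm hm; have -> : (fun U => f U + h U) = (fun U => 1 * f U + h U) by apply/funext => U; rewrite mul1r.
exact: matcoef_lin.
Qed.

Lemma matcoefM f h : matcoef f -> matcoef h -> matcoef (fun U => f U * h U).
Proof.
move=> fm hm; elim: fm => [k l b b' Ab Ab' bb bb'|c f1 f2 _ IH1 _ IH2]; last first.
  have -> : (fun U => (c * f1 U + f2 U) * h U) = (fun U => c * (f1 U * h U) + f2 U * h U).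
    by apply/funext => U; rewrite mulrDl mulrA.
  exact: matcoef_lin.
elim: hm => [p q d d' Ad Ad' db db'|c f1 f2 _ IH1 _ IH2]; last first.
  have -> : (fun U => ip (act U b) b' * (c * f1 U + f2 U)) =
     (fun U => c * (ip (act U b) b' * f1 U) + ip (act U b) b' * f2 U).
    by apply/funext => U; rewrite mulrDr mulrCA.
  exact: matcoef_lin.
have -> : (fun U => ip (act U b) b' * ip (act U d) d') = (fun U => ip (act U (b * d)) (b' * d')).
  by apply/funext => U; rewrite actM (ip_mul _ _ (act_bidegree bb) bb').
by apply: (@matcoef_ip (k + p) (l + q)); do ?[exact: ccM|exact: mul_bidegree].
Qed.

Lemma matcoefX f N : matcoef f -> matcoef (fun U => f U ^+ N).
Proof.
move=> fm; elim: N => [|N IH].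
  have -> : (fun U => f U ^+ 0) = (fun _ => 1) by [].
  exact: matcoef1.
have -> : (fun U => f U ^+ N.+1) = (fun U => f U * f U ^+ N) by apply/funext => U; rewrite exprS.
exact: matcoefM.
Qed.

Lemma matcoef_sum (I : eqType) (r : seq I) (f : I -> M -> C) :
  {in r, forall i, matcoef (f i)} -> matcoef (fun U => \sum_(i <- r) f i U).
Proof.
elim: r => [|i r IH] H.
  have -> : (fun U => \sum_(i <- [::]) f i U) = (fun _ => 0) by apply/funext => U; rewrite big_nil.
  exact: matcoef0.
have -> : (fun U => \sum_(j <- i :: r) f j U) = (fun U => f i U + \sum_(j <- r) f j U).
  by apply/funext => U; rewrite big_cons.
by apply: matcoefD; [apply: H; rewrite mem_head|apply: IH => j jr; apply: H; rewrite inE jr orbT].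
Qed.

Lemma matcoef_translate f g : matcoef f -> g \is unitarymx ->
  ubounded (fun U => f (g *m U)) /\ E (fun U => f (g *m U)) = E f.
Proof.
move=> fm gU; have Bg h : ubounded h -> ubounded (fun U => h (g *m U)).
  by move=> [B HB]; exists B => U UU; apply: HB; exact: mul_unitarymx.
split; first exact/Bg/matcoef_Bd.
elim: fm => [k l b b' _ _ _ _|c f1 f2 fm1 IH1 fm2 IH2]; last first.
  by rewrite !Elin ?IH1 ?IH2 //; do ?[exact: matcoef_Bd|exact/Bg/matcoef_Bd].
rewrite -(Einv b b' gU); apply: E_ext; first exact: (Bg _ (ubounded_ip b b')).
  have [B HB] := ubounded_ip b (act (invmx g) b'); exists B => U UU.
  by rewrite (ip_act _ _ gU); exact: HB.
by move=> U UU; rewrite act_comp // unitary_unit.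
Qed.

(** <b^U, b'> <z^U, z> is the coefficient <(b z)^U, b' z>, where b' z is
    orthogonal to A, and in particular to all permuted powers of I. *)
Lemma matcoef_mean_eq0 k l z f : bidegree k l z ->
  (forall c, A c -> bidegree k l c -> ip z c = 0) ->
  matcoef f -> E (fun U => f U * ip (act U z) z) = 0.
Proof.
move=> zb zA; elim=> [p q b b' Ab Ab' bb bb'|c f1 f2 fm1 IH1 fm2 IH2]; last first.
  have -> : (fun U => (c * f1 U + f2 U) * ip (act U z) z) =
      (fun U => c * (f1 U * ip (act U z) z) + f2 U * ip (act U z) z).
    by apply/funext => U; rewrite mulrDl mulrA.
  rewrite Elin ?IH1 ?IH2 ?mulr0 ?addr0 //.
    by apply: uboundedM; [exact: matcoef_Bd|exact: ubounded_ip].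
  by apply: uboundedM; [exact: matcoef_Bd|exact: ubounded_ip].
have -> : (fun U => ip (act U b) b' * ip (act U z) z) = (fun U => ip (act U (b * z)) (b' * z)).
  by apply/funext => U; rewrite actM (ip_mul _ _ (act_bidegree bb) bb').
apply: (@mean_coef_eq0 (p + k) (q + l)); first exact: mul_bidegree.
move=> sg pq; apply: (cc_perp_mul cA Ab' bb' zA); first exact: cc_Jperm.
rewrite -pq; exact: Jperm_bidegree.
Qed.

End Density.

(** * Invariants of the unitary stabilizer lie in the algebra *)

Section Orbits.
Variables (C : numClosedFieldType) (n : nat).
Hypothesis Clim : bounded_limits C.
Local Notation T := (mtensor C n).
Local Notation M := 'M[C]_n.
Implicit Types (x y z a b : T) (U V g : M) (l : seq T).

Definition dist2 x y : C := ip (x - y) (x - y).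

Lemma dist2_ge0 x y : 0 <= dist2 x y.
Proof. exact: ip_ge0. Qed.

Lemma dist2E x y : dist2 x y = ip x x + ip y y - ip x y - (ip x y)^*.
Proof. by rewrite /dist2 ipBl !ipBr (ipC x y); ring. Qed.

Lemma dist2_act U x y : U \is unitarymx -> dist2 (act U x) (act U y) = dist2 x y.
Proof.
by move=> UU; rewrite !dist2E !(ip_act2 _ _ UU).
Qed.

Lemma star_act_unitary U x : U \is unitarymx -> star (act U x) = act U (star x).
Proof. by move=> UU; rewrite star_act -invmx_unitary // invmxK. Qed.

(** The displacement of a by a unitary matrix is a matrix coefficient of any
    star-closed algebra containing a: the conjugate of <a^U, a> is the coefficient
    of star a. *)
Lemma dist2_star U a : U \is unitarymx ->
  dist2 (act U a) a = 2 * ip a a - (ip (act U a) a + ip (act U (star a)) (star a)).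
Proof.
move=> UU; rewrite dist2E (ip_act2 _ _ UU) -(star_act_unitary _ UU) ip_star.
by rewrite (ipC (act U a) a); ring.
Qed.

Lemma dist2_le x y : dist2 x y <= 2 * ip x x + 2 * ip y y.
Proof. by rewrite /dist2 parallelogram lerBlDr lerDl ip_ge0. Qed.

Lemma dist2_act_le U a : U \is unitarymx -> dist2 (act U a) a <= 4 * ip a a.
Proof.
move=> UU; apply: le_trans (dist2_le _ _) _.
by rewrite (ip_act2 _ _ UU) -mulrDl -natrD.
Qed.

Lemma dist2_limit (X : Type) (F : set_system X) (FF : ProperFilter F) (W : X -> M) U0 a b :
  F [set x | W x \is unitarymx] -> U0 \is unitarymx ->
  (forall z y, cvgF F (fun x : X => ip (act (W x) z) y) (ip (act U0 z) y)) ->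
  cvgF F (fun x : X => dist2 (act (W x) a) b) (dist2 (act U0 a) b).
Proof.
move=> FW UU H; rewrite dist2E (ip_act2 _ _ UU).
apply: (@cvgF_near _ _ _ FF (fun x : X => (ip a a + ip b b + -1 * ip (act (W x) a) b) + -1 * (ip (act (W x) a) b)^*)).
  apply: filterS FW => x /= xU; rewrite dist2E (ip_act2 _ _ xU); ring.
rewrite -[- ip _ _]mulN1r -[- (_^*)]mulN1r.
apply: cvgFD => //; last by apply: cvgFZ => //; exact: cvgF_conj.
by apply: cvgFD => //; [exact: cvgF_cst|exact: cvgFZ].
Qed.

(** Total boundedness of the orbits of l.  Otherwise, for each finite list some
    unitary matrix stays away from all its members; such matrices accumulate at
    some U0, which contradicts the choice for the list consisting of U0. *)
Lemma orbit_net l (d : C) : 0 < d -> exists2 Vs : seq M,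
  {in Vs, forall V, V \is unitarymx} &
  forall U, U \is unitarymx -> exists2 V, V \in Vs & \sum_(a <- l) dist2 (act U a) (act V a) <= d.
Proof.
move=> d0; apply: contrapT => N.
pose D := [set Vs : seq M | {in Vs, forall V, V \is unitarymx}].
pose B (Vs : seq M) := [set U : M | U \is unitarymx /\
  forall V, V \in Vs -> ~ (\sum_(a <- l) dist2 (act U a) (act V a) <= d)].
have BF : Filter (filter_from D B).
  apply: filter_from_filter; first by exists [::].
  move=> Vs Vs' DV DV'; exists (Vs ++ Vs').
    by move=> V; rewrite mem_cat => /orP[/DV|/DV'].
  by move=> U [UU HU]; split; split=> // V VV; apply: HU; rewrite mem_cat VV ?orbT.
have BP : ProperFilter (filter_from D B).
  apply: filter_from_proper => // Vs DV.
  have [//|NB] := pselect (B Vs !=set0); case: N; exists Vs => // U UU.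
  have [//|NV] := pselect (exists2 V, V \in Vs & \sum_(a <- l) dist2 (act U a) (act V a) <= d).
  by case: NB; exists U; split=> // V VV HV; apply: NV; exists V.
have [F [FU BsF]] := ultraFilterLemma BP; have FF := @ultra_proper _ _ FU.
have Fu : F [set U | U \is unitarymx].
  by apply: BsF; exists [::] => // U [].
have [U0 U0U lim] := unitary_limit (U := id) Clim FU Fu.
have FB : F (B [:: U0]) by apply: BsF; exists [:: U0] => // V; rewrite inE => /eqP ->.
have L := cvgF_sum FF l (fun a => @dist2_limit _ _ FF id U0 a (act U0 a) Fu U0U lim).
rewrite [X in cvgF _ _ X]big1 in L; last by move=> a _; rewrite /dist2 subrr ip0l.
have [U [[UU HU] /=]] := filter_ex (filterI FB (L d d0)).
rewrite subr0 ger0_norm => [/ltW H|]; first by case: (HU U0 (mem_head _ _)).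
by apply: sumr_ge0 => a _; exact: dist2_ge0.
Qed.

(** Otherwise there would be unitary matrices that move z by a fixed amount and
    every element of A arbitrarily little.  A limit of these fixes A but not z. *)
Lemma stabilizer_gap (A : set T) z : 0 < ip z z ->
  (forall U, U \is unitarymx -> (forall a, A a -> act U a = a) -> act U z = z) ->
  exists2 l, {in l, forall a, A a} & exists2 d, 0 < d &
    forall U, U \is unitarymx ->
      d <= \sum_(a <- l) dist2 (act U a) a \/ dist2 (act U z) z <= ip z z.
Proof.
move=> z0 zH; apply: contrapT => N.
pose D := [set p : seq T * C | {in p.1, forall a, A a} /\ 0 < p.2].
pose B (p : seq T * C) := [set U : M | [/\ U \is unitarymx,
  ~ (p.2 <= \sum_(a <- p.1) dist2 (act U a) a) & ~ (dist2 (act U z) z <= ip z z)]].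
have sum_ge0 l U : 0 <= \sum_(a <- l) dist2 (act U a) a.
  by apply: sumr_ge0 => a _; exact: dist2_ge0.
have BF : Filter (filter_from D B).
  apply: filter_from_filter; first by exists ([::], 1); split=> //; exact: ltr01.
  move=> [l e] [l' e'] /= [lA e0] [l'A e'0]; exists (l ++ l', Num.min e e').
    split=> /=; last by rewrite /Num.min; case: ifP.
    by move=> a; rewrite mem_cat => /orP[/lA|/l'A].
  have re : Num.min e e' <= e /\ Num.min e e' <= e'.
    have [H|H] := real_leP (gtr0_real e0) (gtr0_real e'0); split=> //; exact: ltW.
  move=> U [UU H1 H2]; split; split=> //= H; apply: H1; rewrite /= big_cat /=.
    by apply: le_trans re.1 (le_trans H _); rewrite lerDl.
  by apply: le_trans re.2 (le_trans H _); rewrite lerDr.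
have BP : ProperFilter (filter_from D B).
  apply: filter_from_proper => // -[l d] [/= lA d0].
  have [//|NB] := pselect (B (l, d) !=set0); case: N; exists l => //; exists d => // U UU.
  have [H1|N1] := pselect (d <= \sum_(a <- l) dist2 (act U a) a); first by left.
  have [H2|N2] := pselect (dist2 (act U z) z <= ip z z); first by right.
  by case: NB; exists U; split.
have [F [FU BsF]] := ultraFilterLemma BP; have FF := @ultra_proper _ _ FU.
have FB l d : {in l, forall a, A a} -> 0 < d -> F (B (l, d)).
  by move=> lA d0; apply: BsF; exists (l, d).
have F1 : F (B ([::], 1)) by apply: FB => //; exact: ltr01.
have Fu : F [set U | U \is unitarymx] by apply: filterS F1 => U [].
have [U0 U0U lim] := unitary_limit (U := id) Clim FU Fu.
have fixA a : A a -> act U0 a = a.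
  move=> Aa; apply/eqP; rewrite -subr_eq0; apply/eqP/ip_eq0.
  apply: (cvgF_unique FF (@dist2_limit _ _ FF id U0 a a Fu U0U lim)) => e e0.
  have aA : {in [:: a], forall a', A a'} by move=> a'; rewrite inE => /eqP ->.
  apply: filterS (FB [:: a] e aA e0) => U [UU] /=; rewrite big_seq1 => /negP H _.
  rewrite subr0 ger0_norm ?dist2_ge0 // real_ltNge //; last exact: gtr0_real.
  by apply: ger0_real; exact: dist2_ge0.
have zz : dist2 (act U0 z) z = 0 by rewrite zH // /dist2 subrr ip0l.
have L := @dist2_limit _ _ FF id U0 z z Fu U0U lim; rewrite zz in L.
have [U [[_ _ /= H1]]] := filter_ex (filterI F1 (L _ z0)).
by rewrite /= subr0 ger0_norm ?dist2_ge0 // => /ltW /H1.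
Qed.

End Orbits.

Section Main.
Variables (C : numClosedFieldType) (n : nat).
Hypotheses (Clim : bounded_limits C) (Cmin : near_minima C) (Cgap : no_gap C).
Local Notation T := (mtensor C n).
Local Notation M := 'M[C]_n.
Implicit Types (x y z a b : T) (U V g : M).
Variable A : set T.
Hypotheses (cA : ccalg A) (AI : A tensI).

(** Matrix coefficients multiply only for homogeneous tensors, so A is probed by
    its homogeneous elements. *)
Definition homog a := exists k l, bidegree k l a.

(** The heart of the proof.  With h = 1 - (displacement of finitely many elements
    of A) / c, the powers h^N peak along the stabilizer of A, where
    psi = <z^U, z> + conjugate equals 2 |z|^2.  Their means against psi vanish as
    z is orthogonal to A; since psi >= (nu - be) + be * h, the means of h^N decay
    geometrically.  But for any rho < 1 there are finitely many translates of h
    of which at every U at least one is >= rho, which bounds the mean of h^N below by a multiple of rho^N. *)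
Lemma invariant_perp_eq0 k l z : bidegree k l z ->
  (forall c, A c -> bidegree k l c -> ip z c = 0) ->
  (forall U, U \is unitarymx -> (forall a, A a -> act U a = a) -> act U z = z) -> z = 0.
Proof.
move=> zb zA zH; apply: ip_eq0; apply/eqP/negPn/negP => z0.
have nu0 : 0 < ip z z by rewrite lt_def z0 ip_ge0.
have [ls lsA [d d0 gap]] : exists2 ls, {in ls, forall a, A a /\ homog a} & exists2 d, 0 < d &
    forall U, U \is unitarymx ->
      d <= \sum_(a <- ls) dist2 (act U a) a \/ dist2 (act U z) z <= ip z z.
  apply: (@stabilizer_gap _ _ Clim [set a | A a /\ homog a]) => // U UU H.
  apply: zH => // a Aa; apply/tensorP => s t.
  have pE x : x@_(bw s t) = (proj (size s) (size t) x)@_(bw s t) by rewrite coef_proj !eqxx.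
  rewrite pE [in RHS]pE -act_proj H //.
  by split; [exact: cc_proj|exists (size s), (size t); exact: proj_bidegree].
have [E [Elin Epos E1 Einv]] := mean_exists n Clim Cmin.
pose S0 : C := \sum_(a <- ls) ip a a.
have S0_ge0 : 0 <= S0 by apply: sumr_ge0 => a _; exact: ip_ge0.
(* Each displacement is at most 4 |a|^2, hence h lies in [0, 1]. *)
pose c := 1 + 4 * S0; have c0 : 0 < c by rewrite ltr_wpDr // mulr_ge0 ?ler0n.
pose fl U : C := \sum_(a <- ls) dist2 (act U a) a.
pose h U : C := 1 + - c^-1 * \sum_(a <- ls) (2 * ip a a + -1 * (ip (act U a) a + ip (act U (star a)) (star a))).
have hE U : U \is unitarymx -> h U = 1 - c^-1 * fl U.
  move=> UU; rewrite /h mulNr; congr (_ - _ * _); apply: eq_bigr => a _.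
  by rewrite dist2_star // mulN1r.
have hm : matcoef A h.
  apply: matcoefD; [exact: matcoef1|apply: (matcoefZ cA); apply: (matcoef_sum cA) => a /lsA[Aa [p [q ab]]]].
  have -> : (fun U => 2 * ip a a + -1 * (ip (act U a) a + ip (act U (star a)) (star a))) =
     (fun U => (2 * ip a a) * 1 + (-1 * ip (act U a) a + -1 * ip (act U (star a)) (star a))).
    by apply/funext => U; rewrite mulr1 -mulrDr.
  apply: matcoef_lin; first exact: matcoef1.
  apply: matcoef_lin; first exact: (matcoef_ip Aa Aa ab ab).
  apply: (matcoefZ cA); have Asa := cc_star cA Aa; have sab := star_bidegree ab.
  exact: (matcoef_ip Asa Asa sab sab).
have fl_ge0 U : 0 <= fl U by apply: sumr_ge0 => a _; exact: dist2_ge0.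
have cfl1 U : U \is unitarymx -> c^-1 * fl U <= 1.
  move=> UU; rewrite mulrC ler_pdivrMr // mul1r; apply: (@le_trans _ _ (4 * S0)).
    rewrite mulr_sumr; apply: ler_sum => a _; exact: dist2_act_le.
  by rewrite lerDr ler01.
have h0 U : U \is unitarymx -> 0 <= h U by move=> UU; rewrite hE // subr_ge0 cfl1.
have hX N : matcoef A (fun U => h U ^+ N) by exact: matcoefX.
have hB N : ubounded (fun U => h U ^+ N) by exact: matcoef_Bd (hX N).
pose nu := ip z z; pose m N := E (fun U => h U ^+ N).
pose psi U : C := ip (act U z) z + ip (act U (star z)) (star z).
have psiE U : U \is unitarymx -> psi U = 2 * nu - dist2 (act U z) z.
  by move=> UU; rewrite dist2_star // opprB addrC subrK.
have psiB : ubounded psi by apply: uboundedD; exact: ubounded_ip.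
have zA' c' : A c' -> bidegree l k c' -> ip (star z) c' = 0.
  move=> Ac' c'b; rewrite -[c']starK ip_star ipC zA ?conjC0 //; first exact: cc_star.
  exact: star_bidegree.
have Epsi N : E (fun U => h U ^+ N * psi U) = 0.
  have -> : (fun U => h U ^+ N * psi U) =
     (fun U => 1 * (h U ^+ N * ip (act U z) z) + h U ^+ N * ip (act U (star z)) (star z)).
    by apply/funext => U; rewrite mul1r -mulrDr.
  rewrite Elin; last 2 first.
  - by apply: uboundedM => //; exact: ubounded_ip.
  - by apply: uboundedM => //; exact: ubounded_ip.
  rewrite (matcoef_mean_eq0 Elin E1 Einv cA AI zb zA (hX N)).
  by rewrite (matcoef_mean_eq0 Elin E1 Einv cA AI (star_bidegree zb) zA' (hX N)) mulr0 addr0.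
(* Where the displacement is at least d the term be * (1 - h) is at least 3 nu,
   which beats psi >= -2 nu; elsewhere psi >= nu already. *)
pose be := 3 * nu * c / d + nu.
have nube : nu < be by rewrite ltrDr !mulr_gt0 ?invr_gt0 ?ltr0n.
have lower U : U \is unitarymx -> (nu - be) + be * h U <= psi U.
  move=> UU; rewrite psiE // hE //.
  have -> : nu - be + be * (1 - c^-1 * fl U) = nu - be * (c^-1 * fl U) by ring.
  have cfl0 : 0 <= c^-1 * fl U by apply: mulr_ge0 (fl_ge0 U); rewrite invr_ge0 ltW.
  have [dfl|zfl] := gap U UU; last first.
    have bfl : 0 <= be * (c^-1 * fl U).
      apply: mulr_ge0 cfl0; apply: ltW; exact: lt_trans nube.
    apply: (@le_trans _ _ nu); first by rewrite lerBlDr lerDl.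
    by rewrite lerBrDr mulr_natl mulr2n lerD2l.
  have b3 : 3 * nu <= be * (c^-1 * fl U).
    apply: (@le_trans _ _ (3 * nu * c / d * (c^-1 * fl U))).
      have -> : 3 * nu * c / d * (c^-1 * fl U) = 3 * nu * (fl U / d).
        by field; rewrite ?gt_eqF.
      rewrite -[X in X <= _]mulr1; apply: ler_wpM2l; first by rewrite mulr_ge0 ?ler0n // ltW.
      by rewrite ler_pdivlMr // mul1r.
    by apply: (ler_wpM2r cfl0); rewrite lerDl ltW.
  apply: (@le_trans _ _ (nu - 3 * nu)); first by rewrite lerD2l lerN2.
  have -> : nu - 3 * nu = 2 * nu - 4 * nu by ring.
  by rewrite lerD2l lerN2; exact: dist2_act_le.
apply: (Cgap (m := m) nu0 nube).
- by rewrite /m -[RHS]E1; congr E; apply/funext => U; rewrite expr0.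
- by move=> N; apply: Epos => // U UU; apply: exprn_ge0; exact: h0.
- move=> N; rewrite /m -(EZ Elin E1 be (hB N.+1)) -Elin //; last by apply: uboundedM => //; exact: ubounded_cst.
  have LB : ubounded (fun U => (nu - be) * h U ^+ N + be * h U ^+ N.+1).
    by apply: uboundedD; apply: uboundedM => //; exact: ubounded_cst.
  have hpB : ubounded (fun U => h U ^+ N * psi U) by exact: uboundedM.
  rewrite -[X in _ <= X](Epsi N) -subr_ge0 addrC -mulN1r -Elin //; apply: Epos.
    by apply: uboundedD => //; apply: uboundedM => //; exact: ubounded_cst.
  move=> U UU; rewrite mulN1r addrC subr_ge0.
  have -> : (nu - be) * h U ^+ N + be * h U ^+ N.+1 = h U ^+ N * (nu - be + be * h U).
    by rewrite exprS; ring.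
  by apply: (ler_wpM2l _ (lower U UU)); apply: exprn_ge0; exact: h0.
move=> rho r0 r1; have cr : 0 < c * (1 - rho) by rewrite mulr_gt0 // subr_gt0.
have [Vs VsU net] := orbit_net Clim ls cr.
exists (size Vs) => N.
have trans V : V \in Vs ->
    ubounded (fun U => h (invmx V *m U) ^+ N) /\ E (fun U => h (invmx V *m U) ^+ N) = m N.
  by move=> /VsU VU; exact: (matcoef_translate Elin Epos Einv (hX N) (unitary_inv VU)).
have SB : {in Vs, forall V, ubounded (fun U => h (invmx V *m U) ^+ N)} by move=> V /trans [].
have -> : (size Vs)%:R * m N = E (fun U => \sum_(V <- Vs) h (invmx V *m U) ^+ N).
  rewrite (E_sum Elin E1 SB) -sum1_size natr_sum mulr_suml !big_seq.
  by apply: eq_bigr => V /trans [_ ->]; rewrite mul1r.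
have rE : - rho ^+ N * E (fun _ => 1) = - rho ^+ N by rewrite E1 mulr1.
rewrite -subr_ge0 addrC -rE -Elin; last 2 first.
- exact: ubounded_cst.
- exact: ubounded_sum.
apply: Epos.
  apply: uboundedD; last exact: ubounded_sum.
  by apply: uboundedM; exact: ubounded_cst.
move=> U UU; rewrite mulr1 addrC subr_ge0.
have [V VV HV] := net U UU; have VU := VsU V VV.
have WU W : W \in Vs -> invmx W *m U \is unitarymx.
  by move=> /VsU /unitary_inv WU; exact: mul_unitarymx.
rewrite (big_rem V VV) /= -[X in X <= _]addr0; apply: lerD; last first.
  rewrite big_seq; apply: sumr_ge0 => W /mem_rem WVs; apply: exprn_ge0; exact/h0/WU.
have hV0 := h0 _ (WU V VV).
suff rh : rho <= h (invmx V *m U) by apply: lerXn2r rh => //; rewrite nnegrE // ltW.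
rewrite (hE _ (WU V VV)) lerBrDl -lerBrDr mulrC ler_pdivrMr // mulrC.
apply: le_trans HV; apply: ler_sum => a _.
rewrite -(dist2_act _ _ VU) -act_comp; last 2 first.
- exact: unitary_unit.
- exact/unitary_unit/WU.
by rewrite mulmxA mulmxV ?mul1mx // unitary_unit.
Qed.

(** Subtracting from an invariant its projection to A leaves an invariant that is
    orthogonal to A. *)
Lemma invariant_in_ccalg z :
  (forall U, U \is unitarymx -> (forall a, A a -> act U a = a) -> act U z = z) -> A z.
Proof.
move=> zH; apply: (cc_of_proj cA) => k l.
have [a [Aa ab za]] := bidegree_decomposition cA (@proj_bidegree C n k l z).
suff -> : proj k l z = a by exact: Aa.
apply/eqP; rewrite -subr_eq0; apply/eqP.
apply: (@invariant_perp_eq0 k l) => //.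
  rewrite addrC -scaleN1r; apply: bidegreeD => //; exact: proj_bidegree.
move=> U UU HU; rewrite addrC -scaleN1r actP (HU a Aa) act_proj zH //.
Qed.

End Main.

Theorem corollary1p2 (R : realType) (n : nat) (hn : (0 < n)%N)
    (S : set (mtensor R[i] n)) (G : set 'M[R[i]]_n) (hG : star_subgroup G)
    (hUG : stabilizer unitary_group S `<=` G)
    (hGGL : G `<=` stabilizer GL S) :
  contraction_closed_graded_star_subalgebra (invariants G) /\
  invariants G =
    smallest (@contraction_closed_graded_star_subalgebra R[i] n)
      (S `|` [set tensI]).
Proof.
have GGL : G `<=` GL by move=> U /hGGL [].
have invA : contraction_closed_graded_star_subalgebra (invariants G).
  exact/ccalgP/invariants_ccalg.
split=> //; apply/seteqP; split=> z.
  move=> /invariantsE zG A [/ccalgP cA SA].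
  apply: (invariant_in_ccalg (@bounded_limits_complex R) (@near_minima_complex R) (@no_gap_complex R) cA).
    by apply: SA; right.
  move=> U UU HU; apply/zG/hUG; split=> // s Ss.
  have := HU s (SA _ (or_introl Ss)); by rewrite [act]unlock.
apply; split=> // s [Ss U /hGGL [_ HU]|->].
  exact: HU.
exact: invariants_tensI.
Qed.
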